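(* Fix $k\in\mathbb N$ and let $p_{\mathbb P_k}(n)$ be the number of partitions of $n$ with all parts in $\mathbb P_k=\{p^k: p\text{ prime}\}$. Let $\Psi(z)=\prod_{p\text{ prime}}(1-z^{p^k})^{-1}=\sum_{n\ge0}p_{\mathbb P_k}(n)z^n$ and $\Phi(z)=\sum_{j=1}^\infty\sum_{p\text{ prime}}\frac1j z^{jp^k}$ (so $\Psi=\exp\Phi$) for $|z|<1$. Let $\rho=\rho(n)\in(0,1)$ be defined by $n=\rho\Phi'(\rho)$ and let $\Phi_{(2)}(\rho)=\left(\rho\frac{d}{d\rho}\right)^2\Phi(\rho)$. Then $$p_{\mathbb P_k}(n)=\frac{\rho^{-n}\Psi(\rho)}{\sqrt{2\pi\Phi_{(2)}(\rho)}}\left(1+O\left(n^{-\frac1{2k+3}}\right)\right).$$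
   Context: The map $\rho\mapsto\rho\Phi'(\rho)$ is continuous and strictly increasing on $(0,1)$ tending to $\infty$ as $\rho\to1^-$, so $\rho(n)$ is well defined for large $n$. Implicit constants may depend on $k$. *)

(* Defs.v *)
From HB Require Import structures.
From mathcomp Require Import all_boot all_order all_algebra.
From mathcomp Require Import all_classical all_reals all_analysis.
Set Implicit Arguments. Unset Strict Implicit. Unset Printing Implicit Defensive.
Import Order.TTheory GRing.Theory Num.Theory.
Import numFieldNormedType.Exports.
Local Open Scope ring_scope.

(* p_{P_k}(n): number of partitions of n into parts p^k (p prime).
   A partition is encoded by its multiplicity function on primes p <= n
   (for k >= 1, p |-> p^k is injective on primes, and any prime part
   p^k <= n has p <= n, multiplicity <= n). *)
Definition pPk (k n : nat) : nat :=
  #|[set f : {ffun 'I_n.+1 -> 'I_n.+1} |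
      [forall i : 'I_n.+1, ~~ prime i ==> (f i == ord0)] &&
      (\sum_(i < n.+1) (f i : nat) * (i : nat) ^ k == n)%N]|.

Definition Phi_term {R : realType} (k : nat) (x : R) (j m : nat) : R :=
  if prime m then x ^+ (j.+1 * m ^ k) / j.+1%:R else 0.

Definition Phi {R : realType} (k : nat) (x : R) : R :=
  limn (fun J : nat => \sum_(j < J)
          limn (fun M : nat => \sum_(m < M) Phi_term k x j m)).

Definition Psi {R : realType} (k : nat) (x : R) : R :=
  limn (fun N : nat => \prod_(m < N | prime m) (1 - x ^+ (m ^ k))^-1).

Definition Phi2 {R : realType} (k : nat) (x : R) : R :=
  x * derive1 (fun y : R => y * derive1 (Phi k) y) x.

(* Main.v *)
(* Saddle-point method. Writing rho = exp(-1/X), the number p(n) rho^n / Psi(rho) is the probability that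
   S = sum_p p^k G_p equals n, where the G_p are independent geometric variables of ratio rho^(p^k); the saddle-point
   equation says that S has mean n, and Phi_(2)(rho) is its variance V. Fourier inversion expresses this probability
   as an integral of the characteristic function of S.
   - For |t| <= t0 every factor of the characteristic function is compared with a Gaussian of the same mean and
     variance; telescoping the product gives an error t^3 times the sum of the third moments, which is O(X^3 P) with
     P^k <= X < (P+1)^k.
   - For t0 <= |t| <= pi the characteristic function is at most exp(-c sum_(p <= P) |sin(p^k t / 2)|^2). If this sum
     were small, p^k t would be extremely close to 2 pi Z for almost all primes p <= P. Primes have density >> 1/log P
     among the integers, so k successive pigeonhole steps produce k-dimensional cubes of such primes with
     edges multiples of any prescribed g; differencing k times leaves q g^k t close to 2 pi Z with q at most a power of
     log P. Varying g up to P / q then forces t itself to be within P^(-k-1/2+eps) of 0.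
   With P = w^(2H) and H = (2k+3)(4k+12), the choice t0 = w^(k+3) / w^H / P^k balances both ranges. *)
Require Import Defs.
From HB Require Import structures.
From mathcomp Require Import all_boot all_order all_algebra.
From mathcomp Require Import all_classical all_reals all_analysis.
From mathcomp Require Import zify ring lra complex.
Set Implicit Arguments. Unset Strict Implicit. Unset Printing Implicit Defensive.
Import Order.TTheory GRing.Theory Num.Theory.
Import numFieldNormedType.Exports.

(** * A lower bound for the number of primes *)

(** The exponent is dictated by the range near 0. Ignoring constants and logarithms, X is P^k, V is
    X^2 P and n is at most P^(k+1). Relative to the main term (2 pi V)^(-1/2), the cubic error X^3 P
    t^3 integrated up to t0 costs X^4 P^(3/2) t0^4. With t0 just above P^(-k-1/2) this is P^(-1/2)
    times a small power of P. The target n^(-1/(2k+3)) is P^(-1/2) P^(1/(2(2k+3))) at n = P^(k+1),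
    and the last factor is the only room available: all losses on t0 must fit in it. Hence the role
    of w, a power of P so small that a fixed number of factors w fits in this room, yet larger than
    every fixed power of log P. It absorbs the logarithm of Chebyshev's bound and the pigeonhole
    multipliers, while exp(-w / 6) stays negligible. The infinite product is never integrated.
    Primes are cut at M and multiplicities at L, so that Fourier inversion concerns a polynomial and
    a finite sum of cosines; M and L grow only once the estimate holds with constants independent of
    them. *)

Definition prime_count (P : nat) : nat := \sum_(0 <= p < P.+1 | prime p) 1.

Lemma pow2_le_central_bin n : 2 ^ n <= 'C(n.*2, n).
Proof.
elim: n => [//|n IH].
have H1 : 'C(n.+1.*2, n.+1) = 2 * 'C(n.*2.+1, n).
  rewrite doubleS binS mulSn mul1n; congr addn.
  by rewrite -bin_sub; [congr binomial|]; lia.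
rewrite H1 expnS leq_mul2l /=; apply: (leq_trans IH).
by case: n {IH H1} => [//|n]; rewrite [X in _ <= X]binS leq_addr.
Qed.

(** By Legendre's formula the valuation is the sum over i of floor(2n / p^i) - 2 floor(n / p^i).
    Each term is 0 or 1, and vanishes once p^i exceeds 2n. *)
Lemma logn_central_bin_le p n : prime p -> 0 < n -> p ^ logn p 'C(n.*2, n) <= n.*2.
Proof.
move=> pp n0.
have p1 := prime_gt1 pp.
set m := n.*2.
have m0 : 0 < m by rewrite double_gt0.
have Hf : logn p m`! = logn p 'C(m, n) + (logn p n`! + logn p n`!).
  have nm : n <= m by rewrite /m; lia.
  have mn : m - n = n by rewrite /m; lia.
  by rewrite -(bin_fact nm) mn !lognM ?muln_gt0 ?fact_gt0 ?bin_gt0.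
have Hn : logn p n`! = \sum_(1 <= i < m.+1) n %/ p ^ i.
  rewrite logn_fact // [RHS](@big_cat_nat _ _ _ n.+1) //=; last by rewrite /m; lia.
  rewrite [X in _ + X]big_nat_cond [X in _ + X]big1 ?addn0 // => i /andP[/andP[ni _] _].
  by rewrite divn_small // (leq_trans _ (ltn_expl _ p1)) // ltnW.
have HB : logn p 'C(m, n) <= \sum_(1 <= i < m.+1) (i <= trunc_log p m).
  suff : logn p m`! <= \sum_(1 <= i < m.+1) (i <= trunc_log p m) + (logn p n`! + logn p n`!).
    by rewrite Hf leq_add2r.
  rewrite Hn logn_fact // -!big_split /=; apply: leq_sum => i _.
  have [li|li] := leqP i (trunc_log p m).
    rewrite /m -addnn /=.
    have := divn_eq n (p ^ i); set q := n %/ _; set r := n %% _ => E.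
    have rl : r < p ^ i by rewrite ltn_mod expn_gt0; lia.
    rewrite -ltnS ltn_divLR ?expn_gt0; last by lia.
    rewrite {1 2}E; nia.
  rewrite divn_small //.
  by apply: leq_trans (trunc_log_ltn m p1) _; rewrite leq_exp2l.
have Ht : trunc_log p m <= m.
  have := @trunc_logP p m p1 m0; have := ltn_expl (trunc_log p m) p1; lia.
apply: leq_trans (trunc_logP p1 m0); rewrite leq_exp2l //.
apply: (leq_trans HB).
rewrite (@big_cat_nat _ _ _ (trunc_log p m).+1) //= [X in _ + X]big_nat_cond.
rewrite [X in _ + X]big1 ?addn0; last by move=> i /andP[/andP[h _] _]; rewrite leqNgt h.
rewrite (leq_trans (@leq_sum _ _ _ _ (fun=> 1) _)) //; first by move=> i _; exact: leq_b1.
by rewrite sum_nat_const_nat muln1 subn1.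
Qed.

(* Chebyshev's lower bound, read off from the prime factorisation of the central binomial coefficient. *)
Lemma prime_count_ge P l : P < 2 ^ l -> P./2 <= l * prime_count P.
Proof.
move=> Pl; set n := P./2.
have [-> //|n0] := posnP n.
have nP : n.*2 <= P by rewrite /n; lia.
set b := 'C(n.*2, n).
have b0 : 0 < b by rewrite bin_gt0; lia.
rewrite -(@leq_exp2l 2) //; apply: (leq_trans (pow2_le_central_bin n)); rewrite -/b.
have bE : b = \prod_(0 <= p < (b + P).+1) p ^ logn p b.
  by rewrite -{1}(partnT b0) (widen_partn _ (leq_addr P b)).
have -> : 2 ^ (l * prime_count P) = \prod_(0 <= p < (b + P).+1 | prime p && (p < P.+1)) 2 ^ l.
  rewrite -big_nat_widen; last by rewrite ltnS leq_addl.
  by rewrite /prime_count expnM expn_sum.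
rewrite {1}bE [X in _ <= X]big_mkcond /=; apply: leq_prod => p _.
case: ifP => [/andP[pp _]|].
  by apply: (leq_trans (logn_central_bin_le pp n0)); apply: leq_trans (ltnW Pl).
have [pp /= h|np _] := boolP (prime p); last by rewrite lognE (negbTE np).
have := logn_central_bin_le pp n0; rewrite -/b.
case: (logn p b) => [//|e] h2.
have : p <= p ^ e.+1 by rewrite expnS leq_pmulr // expn_gt0 prime_gt0.
lia.
Qed.

(** Used with E a multiple of 2H, so that after taking 2H-th roots w = P^(1/(2H)) dominates a
    prescribed power of log P. *)
Lemma polylog_le (E C : nat) : exists P0, forall P, P0 <= P -> C * (trunc_log 2 P).+1 ^ E <= P.
Proof.
have key e n : n ^ e <= (e ^ e) * 2 ^ (n + e).
  case: e => [|e]; first by rewrite !expn0 mul1n expn_gt0.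
  have h : n <= e.+1 * 2 ^ (n %/ e.+1).+1.
    have := divn_eq n e.+1; have := ltn_pmod n (isT : 0 < e.+1).
    have := ltn_expl (n %/ e.+1).+1 (isT : 1 < 2); nia.
  have := leq_exp2r n (e.+1 * 2 ^ (n %/ e.+1).+1) (isT : 0 < e.+1); rewrite h => h2.
  apply: (leq_trans h2); rewrite expnMn leq_mul2l; apply/orP; right.
  by rewrite -expnM leq_exp2l // mulSn addnC leq_add2r leq_trunc_div.
set K := C * (E.+1 ^ E.+1 * 2 ^ E.+1.+1).
exists (2 ^ K) => P hP.
have P0 : 0 < P by apply: leq_trans hP; rewrite expn_gt0.
set l := (trunc_log 2 P).+1.
have h2 : 2 ^ l <= 2 * P by rewrite expnS leq_mul2l /= trunc_logP.
have lK : K < l by rewrite ltnS; apply: trunc_log_max.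
have h3 := key E.+1 l.
(* The bound [key] is taken at exponent E + 1: the extra factor l exceeds K and pays for all the
   constants. *)
have : l * (C * l ^ E) <= l * P.
  rewrite mulnCA -expnS; apply: (@leq_trans (K * P)); last by rewrite leq_mul2r ltnW ?orbT.
  rewrite /K -mulnA leq_mul2l; apply/orP; right; apply: (leq_trans h3).
  rewrite expnD -mulnA leq_mul2l; apply/orP; right.
  by rewrite [2 ^ E.+2]expnS mulnAC leq_mul2r h2 orbT.
by rewrite leq_mul2l.
Qed.

(** * Pigeonhole for translates *)

Lemma big_shift_pred (A : pred nat) (N M s : nat) :
  (forall x, A x -> x < N) -> s + N <= M ->
  \sum_(0 <= x < M) ((s <= x) && A (x - s)) = \sum_(0 <= x < N) A x.
Proof.
move=> AN sM.
rewrite (@big_cat_nat _ _ _ s) //=; last by lia.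
rewrite [X in X + _]big_nat_cond [X in X + _]big1 ?add0n; last first.
  by move=> x /andP[/andP[_ xs] _]; rewrite leqNgt xs.
rewrite (@big_cat_nat _ _ _ (s + N)) //=; last by lia.
rewrite [X in _ + X]big_nat_cond [X in _ + X]big1 ?addn0; last first.
  move=> x /andP[/andP[xs _] _]; case: (boolP (A (x - s))) => [/AN|]; last by rewrite andbF.
  lia.
rewrite -{1}[s]add0n big_addn addKn.
by apply: eq_bigr => x _; rewrite leq_addl addnK.
Qed.

(* If no two of the J translates A + ig overlapped much, they could not fit in [0, 2N); the count uses 2c <= c^2 + 1. *)
Lemma exists_popular_shift (A : pred nat) (N g J : nat) :
  (forall x, A x -> x < N) ->
  4 * N < J * \sum_(0 <= x < N) A x -> J * g <= N -> 0 < N ->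
  exists2 j, 0 < j < J &
    \sum_(0 <= x < N) A x <= 2 * J * \sum_(0 <= x < N) (A x && A (x + j * g)).
Proof.
move=> AN hJ hg N0; set S := \sum_(0 <= x < N) A x.
pose B j := \sum_(0 <= x < N) (A x && A (x + j * g)).
have J0 : 0 < J by rewrite lt0n; apply: contraTneq hJ => ->; lia.
case: (boolP (has (fun j => (0 < j) && (S <= 2 * J * B j)) (iota 0 J))) => [/hasP[j]|].
  by rewrite mem_iota add0n => /andP[_ jJ] /andP[j0 h]; exists j; rewrite ?j0.
move=> /hasPn h.
have hB j : 0 < j < J -> 2 * J * B j < S.
  move=> /andP[j0 jJ]; have := h j; rewrite mem_iota add0n jJ j0 => /(_ isT).
  by rewrite -ltnNge.
pose a i x := ((i * g <= x) && A (x - i * g) : nat).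
have ha i : i < J -> \sum_(0 <= x < N + N) a i x = S.
  move=> iJ; apply: big_shift_pred => //; rewrite leq_add2r; apply: leq_trans hg.
  by rewrite leq_mul2r ltnW ?orbT.
have hab i i' : i < i' -> i' < J -> \sum_(0 <= x < N + N) a i x * a i' x = B (i' - i).
  move=> ii iJ.
  have iJ' := ltn_trans ii iJ.
  pose A' x := A x && A (x + (i' - i) * g).
  rewrite /B -(@big_shift_pred A' N (N + N) (i' * g)); last 2 first.
  - by move=> x /andP[/AN].
  - by rewrite leq_add2r; apply: leq_trans hg; rewrite leq_mul2r ltnW ?orbT.
  apply: eq_bigr => x _; rewrite /a /A' mulnb; congr nat_of_bool.
  have e : i' * g = i * g + (i' - i) * g by rewrite -mulnDl; congr muln; lia.
  case: (leqP (i' * g) x) => h1; last by rewrite andbF.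
  have -> : i * g <= x by apply: leq_trans h1; rewrite e leq_addr.
  rewrite /= andbC; congr (_ && _); congr A.
  move: h1; rewrite e; set u := i * g; set v := (_ * g); move: u v => u v; lia.
have hsum : 2 * (J * S)
    <= \sum_(0 <= x < N + N) ((\sum_(0 <= i < J) a i x) * (\sum_(0 <= i < J) a i x)) + (N + N).
  have <- : \sum_(0 <= x < N + N) \sum_(0 <= i < J) a i x = J * S.
    rewrite exchange_big /= (eq_big_nat _ _ (F2 := fun=> S)); last by move=> i /andP[_]; exact: ha.
    by rewrite sum_nat_const_nat subn0.
  have e : \sum_(0 <= x < N + N) 1 = N + N by rewrite sum_nat_const_nat subn0 muln1.
  rewrite -[X in _ <= _ + X]e big_distrr -big_split /=.
  by apply: leq_sum => x _; case: (\sum_(_ <= _ < _) _) => [|[|c]] //; nia.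
(* Second moment of the covering number: the J diagonal pairs give S each, and by [hB] each
   off-diagonal pair gives less than S / (2 J). With [hsum] this forces J S <= 4 N, against [hJ]. *)
have hsq : 2 * J * \sum_(0 <= x < N + N) ((\sum_(0 <= i < J) a i x) * (\sum_(0 <= i < J) a i x))
    <= 2 * J * (J * S) + J * J * S.
  under eq_bigr do rewrite big_distrlr /=.
  rewrite exchange_big /=.
  under eq_bigr do rewrite exchange_big /=.
  rewrite big_distrr /=.
  apply: (@leq_trans (\sum_(0 <= i < J) (2 * J * S + J * S))); last first.
    by rewrite sum_nat_const_nat subn0; nia.
  rewrite big_nat_cond [X in _ <= X]big_nat_cond; apply: leq_sum => i /andP[/andP[_ iJ] _].
  rewrite big_distrr /=.
  apply: (@leq_trans (\sum_(0 <= i' < J) ((i' == i) * (2 * J * S) + S))); last first.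
    rewrite big_split /= sum_nat_const_nat subn0 leq_add2r.
    rewrite -big_distrl /= -[X in _ <= X]mul1n leq_mul2r; apply/orP; right.
    by rewrite -big_mkcond sum1_count (count_uniq_mem i (iota_uniq _ _)) leq_b1.
  rewrite big_nat_cond [X in _ <= X]big_nat_cond; apply: leq_sum => i' /andP[/andP[_ iJ'] _].
  have [->|] := eqVneq i' i.
    rewrite mul1n; apply: leq_trans (leq_addr _ _); rewrite leq_mul2l; apply/orP; right.
    by rewrite -(ha i iJ); apply: leq_sum => x _; rewrite /a mulnb andbb.
  rewrite neq_ltn mul0n add0n => /orP[] ii; apply: ltnW.
    by under eq_bigr do rewrite mulnC; rewrite hab // hB //; lia.
  by rewrite hab // hB //; lia.
exfalso; rewrite -/S in hJ.
have S0 : 0 < S by rewrite lt0n; apply: contraTneq hJ => ->; rewrite muln0.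
nia.
Qed.

(* Explicit bound for the multiplier produced by [k] successive popular shifts of a set of density [1/a]. *)
Fixpoint shift_mult (k a : nat) : nat :=
  if k is k'.+1 then k * (5 * a) * shift_mult k' (10 * a ^ 2) else 1.

Lemma shift_mult_gt0 k a : 0 < a -> 0 < shift_mult k a.
Proof.
elim: k a => [//|k IH] a a0 /=.
by rewrite !muln_gt0 a0 /= IH // muln_gt0 expn_gt0 a0.
Qed.

(** The density of the primes is about 1 / log P, so polynomial growth in [a] keeps the multiplier
    below a power of log P, hence below w. *)
Lemma shift_mult_poly k : exists C E : nat, forall a, 0 < a -> shift_mult k a <= C * a ^ E.
Proof.
elim: k => [|k [C [E IH]]]; first by exists 1, 0.
exists (k.+1 * 5 * C * 10 ^ E), (2 * E).+1 => a a0 /=.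
have /IH h : 0 < 10 * a ^ 2 by rewrite muln_gt0 expn_gt0 a0.
apply: (@leq_trans (k.+1 * (5 * a) * (C * (10 * a ^ 2) ^ E))).
  by rewrite leq_mul2l h orbT.
by rewrite expnMn -expnM expnS; apply/eq_leq; lia.
Qed.

Local Open Scope ring_scope.

(** * Polynomial phases *)

(* [f] is a polynomial of degree at most [k] with coefficient [c] in degree [k], encoded through its differences. *)
Fixpoint poly_fun {R : realType} (k : nat) (c : R) (f : nat -> R) : Prop :=
  if k is k'.+1 then
    forall h, poly_fun k' (k%:R * h%:R * c) (fun x => f (x + h)%N - f x)
  else forall x, f x = c.

Lemma eq_poly_fun (R : realType) k (c d : R) f g :
  c = d -> f =1 g -> poly_fun k c f -> poly_fun k d g.
Proof.
move=> <-; elim: k c f g => [|k IH] c f g fg /= h; first by move=> x; rewrite -fg.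
by move=> s; apply: IH (h s) => x; rewrite !fg.
Qed.

Lemma poly_funD (R : realType) k (c d : R) f g :
  poly_fun k c f -> poly_fun k d g -> poly_fun k (c + d) (fun x => f x + g x).
Proof.
elim: k c d f g => [|k IH] c d f g /= hf hg; first by move=> x; rewrite hf hg.
by move=> s; apply: eq_poly_fun (IH _ _ _ _ (hf s) (hg s)) => [|x]; ring.
Qed.

Lemma poly_funZ (R : realType) k (a c : R) f :
  poly_fun k c f -> poly_fun k (a * c) (fun x => a * f x).
Proof.
elim: k c f => [|k IH] c f /= hf; first by move=> x; rewrite hf.
by move=> s; apply: eq_poly_fun (IH _ _ (hf s)) => [|x]; ring.
Qed.

Lemma poly_funS (R : realType) k (c : R) f : poly_fun k c f -> poly_fun k.+1 0 f.
Proof.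
elim: k c f => [|k IH] c f hf; first by move=> h x; rewrite !hf; ring.
move=> h; apply: eq_poly_fun (IH _ _ (hf h)) => //; ring.
Qed.

(** Product rule for differences: with df(x) = f(x + h) - f(x), the difference of x f(x) is x df(x)
    + h (df(x) + f(x)). The leading coefficients (k + 1) h c and h c add up. *)
Lemma poly_funX (R : realType) k (c : R) f :
  poly_fun k c f -> poly_fun k.+1 c (fun x => x%:R * f x).
Proof.
elim: k c f => [|k IH] c f hf h.
  by move=> x; rewrite !hf natrD; ring.
have H1 := IH _ _ (hf h).
have H2 := poly_funZ h%:R (poly_funD (poly_funS (hf h)) hf).
apply: eq_poly_fun (poly_funD H1 H2) => [|x]; last by rewrite natrD; ring.
by rewrite -[in RHS]natr1; ring.
Qed.

Lemma poly_fun_monomial (R : realType) k (c : R) : poly_fun k c (fun x => (x ^ k)%:R * c).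
Proof.
elim: k => [|k IH]; first by move=> x; rewrite mul1r.
by apply: eq_poly_fun (poly_funX IH) => // x; rewrite expnS natrM mulrA.
Qed.

(* Half the distance from [expi x] to 1; comparable with the distance from [x] to [2 pi Z]. *)
Definition circ_dist {R : realType} (x : R) : R := `|sin (x / 2)|.

Lemma circ_dist_ge0 (R : realType) (x : R) : 0 <= circ_dist x.
Proof. exact: normr_ge0. Qed.

Lemma circ_distN (R : realType) (x : R) : circ_dist (- x) = circ_dist x.
Proof. by rewrite /circ_dist mulNr sinN normrN. Qed.

Lemma circ_distD (R : realType) (x y : R) : circ_dist (x + y) <= circ_dist x + circ_dist y.
Proof.
rewrite /circ_dist mulrDl sinD; apply: (le_trans (ler_normD _ _)).
have cos1 (z : R) : `|cos z| <= 1 by rewrite ler_norml cos_geN1 cos_le1.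
rewrite !normrM; apply: lerD; first exact: ler_piMr.
exact: ler_piMl.
Qed.

Lemma circ_distB (R : realType) (x y : R) : circ_dist (x - y) <= circ_dist x + circ_dist y.
Proof. by rewrite (le_trans (circ_distD _ _)) // circ_distN. Qed.

Lemma circ_distMn (R : realType) (x : R) n : circ_dist (n%:R * x) <= n%:R * circ_dist x.
Proof.
elim: n => [|n IH]; first by rewrite !mul0r /circ_dist mul0r sin0 normr0.
rewrite -natr1 !mulrDl !mul1r (le_trans (circ_distD _ _)) //.
by rewrite lerD2r.
Qed.

Lemma circ_dist_sqr (R : realType) (x : R) : 1 - cos x = 2 * circ_dist x ^+ 2.
Proof.
rewrite /circ_dist real_normK ?num_real // [in LHS](splitr x) cosD.
by have := cos2Dsin2 (x / 2); lra.
Qed.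

(** Weyl differencing on a set of density 1/a. A popular shift j g leaves density at least 1/(10
    a^2) in A and its translate together; there f(x + j g) - f(x) has degree one less and
    [circ_dist] at most 2 d. After k rounds only a constant is left, and the product of the factors
    k j collected on the way is the multiplier q. *)
Lemma poly_fun_dense_circ_dist (R : realType) k a N g (A : pred nat) (f : nat -> R) c d :
  poly_fun k c f -> (forall x, A x -> (x < N)%N) -> (0 < N)%N -> (0 < a)%N ->
  (N <= a * \sum_(0 <= x < N) A x)%N -> (forall x, A x -> circ_dist (f x) <= d) ->
  (g * shift_mult k a <= N)%N ->
  exists2 q, (0 < q <= shift_mult k a)%N & circ_dist ((q * g ^ k)%:R * c) <= 2 ^+ k * d.
Proof.
elim: k a A f c d => [|k IH] a A f c d hf AN N0 a0 hA hd hg.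
  have [x Ax] : exists x, A x.
    apply: contrapT => hn; move: hA; rewrite leqNgt big1 ?muln0 ?N0 // => x _.
    by case: (boolP (A x)) => // Ax; case: hn; exists x.
  by exists 1%N => //; rewrite mul1r -(hf x) expr0 mul1r; apply: hd.
set S := (\sum_(0 <= x < N) A x)%N in hA *.
have S0 : (0 < S)%N by rewrite lt0n; apply: contraTneq hA => ->; rewrite muln0 -ltnNge.
have a10 : (0 < 10 * a ^ 2)%N by rewrite muln_gt0 expn_gt0 a0.
have Q0 := shift_mult_gt0 k a10.
move: hg => /=; set Q := shift_mult k _ in Q0 * => hg.
(* J = 4 a + 1 translates exceed the pigeonhole threshold, since N <= a S gives 4 N < J S. *)
have [j /andP[j0 jJ] hj] : exists2 j, (0 < j < 4 * a + 1)%N &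
    (S <= 2 * (4 * a + 1) * \sum_(0 <= x < N) (A x && A (x + j * g)))%N.
  apply: exists_popular_shift => //; first by rewrite -/S; nia.
  apply: leq_trans hg; rewrite mulnC leq_mul2l; apply/orP; right; nia.
have [||||||q /andP[q0 qQ] hq] :=
    IH (10 * a ^ 2)%N (fun x => A x && A (x + j * g)%N) _ _ (2 * d) (hf (j * g)%N).
- by move=> x /andP[/AN].
- by [].
- by [].
(* The new inverse density is 2 a (4 a + 1), at most 10 a^2. *)
- set T := (\sum_(0 <= x < N) _)%N in hj *.
  have : (a * S <= a * (2 * (4 * a + 1) * T))%N by rewrite leq_mul2l hj orbT.
  nia.
- move=> x /andP[Ax Ax']; apply: (le_trans (circ_distB _ _)).
  by rewrite mulr_natl mulr2n lerD // hd.
- apply: leq_trans hg; rewrite leq_mul2l -/Q; apply/orP; right; nia.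
exists (k.+1 * j * q)%N.
  rewrite !muln_gt0 j0 q0 /=; apply: leq_mul => //; rewrite leq_mul2l; apply/orP; right; lia.
have -> : (k.+1 * j * q * g ^ k.+1)%:R * c = (q * g ^ k)%:R * (k.+1%:R * (j * g)%:R * c) :> R.
  by rewrite expnS !natrM; ring.
by apply: (le_trans hq); rewrite exprSr mulrA.
Qed.

(** Starting from 1 - cos >= 0, this integrates each Taylor bound for sine and cosine into the next
    one. *)
Lemma ge0_of_derive_ge0 (R : realType) (f f' : R -> R) :
  (forall x : R, is_derive x (1 : R) f (f' x)) -> (forall x : R, 0 <= x -> 0 <= f' x) ->
  0 <= f 0 -> forall x : R, 0 <= x -> 0 <= f x.
Proof.
move=> df f'0 f0 x x0.
have cf : {within `[0, x], continuous f}%classic.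
  apply: continuous_subspaceT => y.
  by apply: differentiable_continuous; apply/derivable1_diffP; apply: ex_derive.
have [c c0x e] := MVT_segment x0 (fun y _ => df y) cf.
move: c0x; rewrite in_itv /= => /andP[c0 _].
rewrite -(subrK (f 0) (f x)) e addr_ge0 // mulr_ge0 ?subr_ge0 //.
exact: f'0.
Qed.

Lemma sin_le (R : realType) (x : R) : 0 <= x -> sin x <= x.
Proof.
move=> x0; rewrite -subr_ge0.
apply: (@ge0_of_derive_ge0 R (fun y => y - sin y) (fun y => 1 - cos y)) => //.
- by rewrite sin0 subr0 lexx.
Qed.

Lemma cos_ge (R : realType) (x : R) : 0 <= x -> 1 - x ^+ 2 / 2 <= cos x.
Proof.
move=> x0; rewrite -subr_ge0.
apply: (@ge0_of_derive_ge0 R (fun y => cos y - (1 - y ^+ 2 / 2)) (fun y => y - sin y)) => //.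
- move=> y; apply: is_derive_eq; rewrite /GRing.scale /=; by field.
- by move=> y y0; rewrite subr_ge0 sin_le.
- by rewrite cos0; lra.
Qed.

Lemma sin_ge (R : realType) (x : R) : 0 <= x -> x - x ^+ 3 / 6 <= sin x.
Proof.
move=> x0; rewrite -subr_ge0.
apply: (@ge0_of_derive_ge0 R (fun y => sin y - (y - y ^+ 3 / 6)) (fun y => cos y - (1 - y ^+ 2 / 2))) => //.
- move=> y; apply: is_derive_eq; rewrite /GRing.scale /=; by field.
- by move=> y y0; rewrite subr_ge0 cos_ge.
- by rewrite sin0; lra.
Qed.

(** The remainder is cubic, not quartic, to match the order th^3 of the comparison with the
    Gaussian. *)
Lemma cos_le_cubic (R : realType) (x : R) : 0 <= x -> cos x <= 1 - x ^+ 2 / 2 + x ^+ 3 / 3.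
Proof.
move=> x0; rewrite -subr_ge0.
apply: (@ge0_of_derive_ge0 R (fun y => 1 - y ^+ 2 / 2 + y ^+ 3 / 3 - cos y) (fun y => y ^+ 2 - y + sin y)) => //.
- move=> y; apply: is_derive_eq; rewrite /GRing.scale /=; by field.
(* Up to 6 the derivative is at least y^2 - y^3 / 6 by [sin_ge]; beyond 6, y^2 - y exceeds 1. *)
- move=> y y0; have [y6|y6] := leP y 6.
    have := sin_ge y0; suff : 0 <= y ^+ 2 * (6 - y) by nra.
    by rewrite mulr_ge0 ?sqr_ge0 ?subr_ge0.
  by have := sin_geN1 y; nra.
- by rewrite cos0; lra.
Qed.

Lemma circ_distD2pi (R : realType) (x : R) : circ_dist (x + 2 * pi) = circ_dist x.
Proof.
rewrite /circ_dist mulrDl [2 * pi]mulrC mulfK ?pnatr_eq0 //.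
by rewrite sinDpi normrN.
Qed.

Lemma circ_distD2pin (R : realType) (x : R) n : circ_dist (x + n%:R * (2 * pi)) = circ_dist x.
Proof.
elim: n => [|n IH]; first by rewrite mul0r addr0.
by rewrite -natr1 mulrDl mul1r addrA circ_distD2pi.
Qed.

Lemma circ_distD2piz (R : realType) (x : R) (z : int) :
  circ_dist (x + z%:~R * (2 * pi)) = circ_dist x.
Proof.
case: z => n; first exact: circ_distD2pin.
rewrite NegzE -[LHS](circ_distD2pin _ n.+1); congr circ_dist.
by rewrite -addrA -mulrDl mulrNz pmulrn addNr mul0r addr0.
Qed.

(** A crude Jordan inequality (the sharp constant is pi): [sin_ge] handles |x| <= 2, and beyond that
    sin(|x| / 2) >= sin 1 >= 5/6 by monotonicity. *)
Lemma norm_le_circ_dist (R : realType) (x : R) : `|x| <= pi -> `|x| <= 6 * circ_dist x.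
Proof.
have pos (y : R) : 0 <= y <= pi -> y <= 6 * circ_dist y.
  move=> /andP[y0 yp].
  have hp : pi / 2 < 2 :> R := pihalf_lt2 R.
  rewrite /circ_dist ger0_norm; last by apply: sin_ge0_pi; rewrite divr_ge0 //= ; lra.
  have [y2|y2] := leP (y / 2) 1.
    have := @sin_ge R (y / 2) ltac:(lra); nra.
  have : sin 1 < sin (y / 2) by rewrite ltr_sin ?in_itv //=; lra.
  have := @sin_ge R 1 ler01; lra.
move=> h; have [x0|x0] := leP 0 x.
  by move: h; rewrite ger0_norm // => h; apply: pos; rewrite x0.
by rewrite -circ_distN; move: h; rewrite ltr0_norm // => h; apply: pos; rewrite h andbT; lra.
Qed.

Lemma near_2piz (R : realType) (x : R) :
  exists z : int, exists2 y : R, x = z%:~R * (2 * pi) + y & `|y| <= pi.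
Proof.
have p0 := pi_gt0 R.
exists (Num.floor ((x + pi) / (2 * pi))); set z := (_%:~R).
exists (x - z * (2 * pi)); first by ring.
have h1 : z <= (x + pi) / (2 * pi) by exact: Num.Theory.floor_le.
have h2 : (x + pi) / (2 * pi) < z + 1 by have := Num.Theory.floorD1_gt ((x + pi) / (2 * pi)); rewrite intrD.
move: h1 h2; rewrite ler_pdivlMr ?ltr_pdivrMr ?mulr_gt0 // => h1 h2.
rewrite ler_norml; apply/andP; split; nra.
Qed.

(* If [p^k t] is nearly integral modulo 2 pi for a positive proportion of primes, then so is [q g^k t] for every
   step [g], with a small multiplier [q]; letting [g] grow forces [t] to be extremely close to a rational multiple
   of 2 pi of small denominator, and a prime [p] coprime to that denominator shows that the denominator is 1. *)
Lemma norm_le_of_prime_powers (R : realType) (k P a : nat) (A : pred nat) (t d : R) :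
  let Q := shift_mult k a in
  let eta := 2 ^+ k * d in
  let kappa := (2 * Q%:R) ^+ k * (6 * Q%:R * eta) in
  (0 < k)%N -> (0 < a)%N -> (Q <= P)%N ->
  (forall x, A x -> [/\ prime x, (Q < x <= P)%N & circ_dist ((x ^ k)%:R * t) <= d]) ->
  (P.+1 <= a * \sum_(0 <= x < P.+1) A x)%N -> `|t| <= pi ->
  2 ^+ k * (6 * Q%:R ^+ 2 * eta) <= 2 -> 6 * Q%:R * d + kappa <= 3 ->
  P%:R ^+ k * `|t| <= kappa.
Proof.
move=> Q eta kappa k0 a0 QP hA hcount tpi c1 c2.
have Q0 : (0 < Q)%N by exact: shift_mult_gt0.
have Q1 : 1 <= Q%:R :> R by rewrite ler1n.
have [p Ap] : exists x, A x.
  apply: contrapT => hn; move: hcount; rewrite leqNgt big1 ?muln0 // => x _.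
  by case: (boolP (A x)) => // Ax; case: hn; exists x.
have [pp /andP[Qp pP] hp] := hA p Ap.
have d0 : 0 <= d by apply: le_trans hp; exact: circ_dist_ge0.
have eta0 : 0 <= eta by rewrite mulr_ge0 ?exprn_ge0.
have pi0 := pi_gt0 R; have pi2 := pi_ge2 R.
have main g : (g * Q <= P)%N -> exists2 q, (0 < q <= Q)%N & circ_dist ((q * g ^ k)%:R * t) <= eta.
  move=> gQ; apply: (@poly_fun_dense_circ_dist R k a P.+1 g A _ t d (poly_fun_monomial k t)) => //.
  - by move=> x /hA[_ /andP[_]].
  - by move=> x /hA[].
  - exact: leqW.
have [|q1 /andP[q10 q1Q] hq1] := main 1%N; first by rewrite mul1n.
have q1Q' : q1%:R <= Q%:R :> R by rewrite ler_nat.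
rewrite exp1n muln1 in hq1.
have [z [b eb bpi]] := near_2piz (q1%:R * t).
have b1 : `|b| <= 6 * eta.
  apply: (le_trans (norm_le_circ_dist bpi)); rewrite ler_pM2l //; apply: le_trans hq1.
  by rewrite eb addrC circ_distD2piz.
have hg g : (0 < g)%N -> (g * Q <= P)%N -> Q%:R * (g%:R ^+ k * `|b|) <= 2 ->
    g%:R ^+ k * `|b| <= 6 * Q%:R * eta.
  move=> g0 gP hb.
  have [q /andP[q0 qQ] hq] := main g gP.
  have qQ' : q%:R <= Q%:R :> R by rewrite ler_nat.
  have q1' : 1 <= q%:R :> R by rewrite ler1n.
  have gb0 : 0 <= g%:R ^+ k * `|b| by rewrite mulr_ge0 // exprn_ge0.
  have e : (q * g ^ k)%:R * b = q1%:R * ((q * g ^ k)%:R * t) + (- ((q * g ^ k)%:Z * z))%:~R * (2 * pi).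
    have -> : b = q1%:R * t - z%:~R * (2 * pi) by rewrite eb; ring.
    rewrite mulrNz intrM -[(Posz _)%:~R]/((q * g ^ k)%:R : R); ring.
  have nb : `|(q * g ^ k)%:R * b| = q%:R * (g%:R ^+ k * `|b|).
    by rewrite normrM normr_nat natrM natrX mulrA.
  have h1 : circ_dist ((q * g ^ k)%:R * b) <= Q%:R * eta.
    rewrite e circ_distD2piz; apply: (le_trans (circ_distMn _ _)).
    by apply: ler_pM => //; exact: circ_dist_ge0.
  have : `|(q * g ^ k)%:R * b| <= 6 * circ_dist ((q * g ^ k)%:R * b).
    apply: norm_le_circ_dist; rewrite nb; apply: le_trans (ler_wpM2r gb0 qQ') _.
    exact: le_trans hb pi2.
  rewrite nb => h2; have := ler_wpM2r gb0 q1'; rewrite mul1r; lra.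
(* Growing g one unit at a time prevents wrapping around the circle: g^k grows at most by 2^k per
   step, so by [c1] the bound for g keeps Q (g + 1)^k |b| below 2, where [circ_dist] controls the
   real number and not only its class modulo 2 pi. *)
have hG g : (0 < g)%N -> (g * Q <= P)%N -> g%:R ^+ k * `|b| <= 6 * Q%:R * eta.
  elim: g => [//|[|g] IH] _ gP.
    by have := ler_wpM2r eta0 Q1; rewrite expr1n mul1r; lra.
  apply: hg => //.
  have := IH isT (leq_trans (leq_mul (leqnSn _) (leqnn _)) gP).
  have : g.+2%:R ^+ k <= 2 ^+ k * g.+1%:R ^+ k :> R.
    by rewrite -exprMn; apply: lerXn2r; rewrite ?nnegrE // -natrM ler_nat mulSn mul1n addnS ltnS leq_addr.
  have := normr_ge0 b.
  move: (g.+2%:R ^+ k) (g.+1%:R ^+ k) `|b| => u v b' b0 uv vb.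
  have h1 : u * b' <= 2 ^+ k * (6 * Q%:R * eta).
    by apply: (le_trans (ler_wpM2r b0 uv)); rewrite -[leLHS]mulrA ler_wpM2l ?exprn_ge0.
  apply: le_trans c1; rewrite (_ : _ * _ = Q%:R * (2 ^+ k * (6 * Q%:R * eta))); last by ring.
  by rewrite ler_pM2l ?ltr0n.
have kap : P%:R ^+ k * `|b| <= kappa.
  set G := (P %/ Q)%N.
  have G0 : (0 < G)%N by rewrite divn_gt0.
  have hGG := hG G G0 (leq_trunc_div _ _).
  have PG : P%:R <= 2 * Q%:R * G%:R :> R.
    rewrite -!natrM ler_nat {1}(divn_eq P Q) -/G -mulnA mulSn mul1n mulnC leq_add2l.
    by apply: (leq_trans (ltnW (ltn_pmod P Q0))); rewrite leq_pmulr.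
  apply: (@le_trans _ _ ((2 * Q%:R) ^+ k * (G%:R ^+ k * `|b|))).
    rewrite mulrA -exprMn; apply: ler_wpM2r => //.
    by apply: lerXn2r; rewrite ?nnegrE ?mulr_ge0.
  by rewrite ler_wpM2l // exprn_ge0 // mulr_ge0.
have [z2 [c ec cpi]] := near_2piz ((p ^ k)%:R * t).
have c6 : `|c| <= 6 * d.
  apply: (le_trans (norm_le_circ_dist cpi)); rewrite ler_pM2l //; apply: le_trans hp.
  by rewrite ec addrC circ_distD2piz.
have pb : (p ^ k)%:R * `|b| <= kappa.
  apply: le_trans kap; apply: ler_wpM2r => //.
  by rewrite natrX; apply: lerXn2r; rewrite ?nnegrE // ler_nat.
(* Both sides approximate q1 p^k t / (2 pi): the integer m has |2 pi m| <= 3 by [c2], so it is 0. As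
   p > Q >= q1 is coprime to q1, this makes q1 divide z. *)
set m : int := ((p ^ k)%:Z * z - q1%:Z * z2)%R.
have em : m%:~R * (2 * pi) = q1%:R * c - (p ^ k)%:R * b :> R.
  have -> : b = q1%:R * t - z%:~R * (2 * pi) by rewrite eb; ring.
  have -> : c = (p ^ k)%:R * t - z2%:~R * (2 * pi) by rewrite ec; ring.
  rewrite /m intrB !intrM -![(Posz _)%:~R]/(_%:R); ring.
have m0 : m = 0.
  apply/eqP; rewrite -[_ == _]negbK; apply/negP => mn0.
  have m1 : 1 <= `|m%:~R| :> R by rewrite -intr_norm ler1z -gtz0_ge1 normr_gt0.
  have : `|m%:~R * (2 * pi)| <= 3 :> R.
    rewrite em; apply: le_trans c2; apply: (le_trans (ler_normB _ _)).
    rewrite !normrM !normr_nat; apply: lerD => //.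
    apply: (@le_trans _ _ (q1%:R * (6 * d))); first by rewrite ler_wpM2l.
    by rewrite mulrCA mulrA ler_wpM2r // ler_wpM2l.
  rewrite normrM (ger0_norm (_ : 0 <= 2 * pi)); last by lra.
  nra.
have q1z : (q1 %| `|z|)%N.
  have : (q1 %| p ^ k * `|z|)%N.
    have e : (p ^ k)%:Z * z = q1%:Z * z2 by apply/eqP; rewrite -subr_eq0 -/m m0.
    by apply/dvdnP; exists `|z2|%N; have := congr1 absz e; rewrite !abszM /= mulnC => ->; rewrite mulnC.
  rewrite Gauss_dvdr // coprime_sym coprimeXl // prime_coprime //.
  by apply/negP => /dvdn_leq -/(_ q10); rewrite leqNgt (leq_ltn_trans q1Q Qp).
(* A nonzero multiple z of q1 would give |q1 t| >= 2 pi q1 - 1, incompatible with |t| <= pi. *)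
have z0 : z = 0.
  apply/eqP; rewrite -absz_eq0 -leqn0 leqNgt; apply/negP => zn.
  have [e ee] := dvdnP q1z.
  have e0 : (0 < e)%N by move: zn; rewrite ee muln_gt0 => /andP[].
  have b1' : `|b| <= 1.
    have k2 : 2 <= 2 ^+ k :> R by rewrite -[leLHS]expr1 ler_weXn2l // ler1n.
    have : 2 * (6 * eta) <= 2 ^+ k * (6 * Q%:R ^+ 2 * eta).
      apply: ler_pM => //; first by rewrite mulr_ge0.
      by rewrite ler_wpM2r // ler_peMr // expr_ge1.
    lra.
  have h : `|q1%:R * t - b| <= q1%:R * pi + 1.
    apply: (le_trans (ler_normB _ _)); rewrite normrM normr_nat; apply: lerD => //.
    by rewrite ler_wpM2l.
  have e1 : 1 <= e%:R :> R by rewrite ler1n.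
  have q1r : 1 <= q1%:R :> R by rewrite ler1n.
  have : 1 * (q1%:R * (2 * pi)) <= e%:R * (q1%:R * (2 * pi)) :> R.
    by rewrite ler_wpM2r // !mulr_ge0 // ltW.
  have : 1 * pi <= q1%:R * pi :> R by rewrite ler_wpM2r // ltW.
  have npi : `|2 * pi| = 2 * pi :> R by rewrite ger0_norm // mulr_ge0 // ltW.
  have nz : `|z%:~R| = e%:R * q1%:R :> R by rewrite -intr_norm -abszE ee -natrM.
  by move: h; rewrite eb addrK normrM npi nz; lra.
move: eb; rewrite z0 mul0r add0r => eb.
apply: le_trans kap; apply: ler_wpM2l; first by rewrite exprn_ge0.
by rewrite -eb normrM normr_nat ler_peMl // ler1n.
Qed.

(** * Minor arcs *)

Lemma sum_leq_minn n m : (\sum_(0 <= x < n) (x <= m) = minn n m.+1)%N.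
Proof.
elim: n => [|n IH]; first by rewrite big_geq // min0n.
by rewrite big_nat_recr //= IH; lia.
Qed.

Lemma leq_of_half n m : (n./2 <= m -> n <= (2 * m).+1)%N.
Proof. lia. Qed.

(** Here p counts the primes up to P, c the good ones, Q + 1 the small ones discarded and P / (16 w)
    the ones far from 2 pi Z. After multiplication by l both losses are small fractions of P, so the
    good primes have density at least 1/(8 l). *)
Lemma count_arith (R : realFieldType) (P l Q K w c p : R) :
  4 <= P -> 1 <= l -> 1 <= Q -> 32 <= K -> K * Q <= w -> K * l <= w -> w ^+ 2 <= P ->
  P <= 2 * (l * p) + 1 -> p <= c + (Q + 1) + P / (16 * w) -> P + 1 <= 8 * l * c.
Proof.
move=> P4 l1 Q1 K1 KQ Kl wP Pp pc.
have w0 : 0 < w by nra.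
have h1 : 32 * (l * Q) <= P.
  apply: le_trans wP; rewrite expr2; apply: le_trans (ler_pM _ _ Kl KQ); [|nra|nra].
  rewrite mulrACA ler_wpM2r ?mulr_ge0 //; nra.
have h2 : l * (P / (16 * w)) <= P / 16.
  have lw : l <= w by nra.
  rewrite mulrA ler_pdivrMr ?mulr_gt0 //; nra.
have h3 : l * p <= l * (c + (Q + 1) + P / (16 * w)) by rewrite ler_pM2l //; lra.
nra.
Qed.

(** If the sum were below w, Markov's inequality would leave a proportion 1/(8 l) of integers that
    are primes with p^k t nearly in 2 pi Z. Then [norm_le_of_prime_powers] bounds P^k t by w^(k+2) /
    w^H, a factor w below the assumed lower bound. *)
Lemma minor_arc_sum (R : realType) (k H : nat) : (0 < k)%N -> (k + 8 <= H)%N ->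
  exists P0 : nat, forall (P : nat) (w : R), (P0 <= P)%N -> 0 < w -> w ^+ (2 * H) = P%:R ->
  forall t, w ^+ (k + 3) / w ^+ H / P%:R ^+ k <= t -> t <= pi ->
  w <= \sum_(0 <= p < P.+1 | prime p) circ_dist ((p ^ k)%:R * t) ^+ 2.
Proof.
move=> k0 kH.
have c1 : 24 / 32 < 1 :> R by lra.
have [C [E hE]] := shift_mult_poly k.
(* K absorbs the constants of kappa: two factors 2^k, and 24 = 6 times the 4 of [d], below 32. *)
have [K KE] : exists K, K = (2 ^ (2 * k + 5))%N by eexists.
have K8 : (32 <= K)%N by rewrite KE expnD leq_pmull // expn_gt0.
have {KE}Kk : K%:R = 2 ^+ (2 * k + 5) :> R by rewrite KE natrX.
have [P1 hP1] := polylog_le (E.+1 * (2 * H)) ((K * (C * 8 ^ E).+1) ^ (2 * H)).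
exists (maxn P1 4) => P w; rewrite geq_max => /andP[PP1 P4] w0 wP t t1 t2.
set l := (trunc_log 2 P).+1.
have l0 : (0 < l)%N by [].
have Hgt0 : (0 < 2 * H)%N by lia.
have H2 : (1 < 2 * H)%N by lia.
have h1 : (K * (C * 8 ^ E).+1 * l ^ E.+1)%:R <= w.
  rewrite -(ler_pXn2r Hgt0) ?nnegrE ?(ltW w0) //.
  by rewrite wP -natrX ler_nat expnMn -expnM hP1.
set Q := shift_mult k (8 * l).
have Q0 : (0 < Q)%N by apply: shift_mult_gt0.
have hQ : (Q <= C * 8 ^ E * l ^ E)%N by rewrite -mulnA -expnMn; apply: hE.
have KQ : K%:R * Q%:R <= w.
  apply: le_trans h1; rewrite -natrM ler_nat -mulnA leq_mul2l; apply/orP; right.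
  by apply: (leq_trans hQ); apply: leq_mul => //; rewrite leq_pexp2l.
have Kl : K%:R * l%:R <= w.
  apply: le_trans h1; rewrite -natrM ler_nat -mulnA leq_mul2l; apply/orP; right.
  by rewrite expnS mulnCA leq_pmulr // muln_gt0 /= expn_gt0.
have K1 : 32 <= K%:R :> R by rewrite (ler_nat _ 32).
have Q1 : 1 <= Q%:R :> R by rewrite ler1n.
have l1 : 1 <= l%:R :> R by rewrite ler1n.
have w1 : 32 <= w by nra.
have w1' : 1 <= w by lra.
have Pr : 4 <= P%:R :> R by rewrite (ler_nat _ 4).
have wH e : (e <= H)%N -> w ^+ e / w ^+ H <= 1.
  by move=> eH; rewrite ler_pdivrMr ?exprn_gt0 // mul1r ler_weXn2l.
rewrite leNgt; apply/negP => hs.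
have wn0 : w != 0 by rewrite gt_eqF.
have Pn0 : P%:R != 0 :> R by rewrite pnatr_eq0 -lt0n; apply: leq_trans P4.
have wH0 : 0 < w ^+ H by rewrite exprn_gt0.
(* Chosen so that w / d^2 = P / (16 w), the Markov bound for the number of exceptional primes, is
   negligible against P / log P. *)
set d := 4 * w / w ^+ H.
have d0 : 0 < d by rewrite !(divr_gt0, mulr_gt0, exprn_gt0).
have d2 : d ^+ 2 = 16 * w ^+ 2 / P%:R.
  rewrite -wP [(2 * H)%N]mulnC exprM /d; have := wH0; move: (w ^+ H) => v v0.
  by field; rewrite gt_eqF.
pose A p := [&& prime p, (Q < p <= P)%N & circ_dist ((p ^ k)%:R * t) <= d].
have hA x : A x -> [/\ prime x, (Q < x <= P)%N & circ_dist ((x ^ k)%:R * t) <= d] by move=> /and3P.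
have cnt : (prime_count P)%:R <= (\sum_(0 <= x < P.+1) A x)%:R + (Q%:R + 1) + P%:R / (16 * w) :> R.
  have -> : P%:R / (16 * w) = w / d ^+ 2 by rewrite d2; field; rewrite wn0 Pn0.
  apply: (@le_trans _ _ ((\sum_(0 <= x < P.+1) A x)%:R + (\sum_(0 <= x < P.+1) (x <= Q)%N)%:R
    + (\sum_(0 <= p < P.+1 | prime p) circ_dist ((p ^ k)%:R * t) ^+ 2) / d ^+ 2)).
    rewrite /prime_count !natr_sum mulr_suml [X in X <= _]big_mkcond [X in _ + X]big_mkcond -!big_split /=.
    rewrite big_nat_cond [leRHS]big_nat_cond; apply: ler_sum => x /andP[/andP[_ xP] _].
    case: ifP => px; last by rewrite addr0 addr_ge0.
    rewrite /A px -(ltnS x P) xP andbT /=; case: leqP => /= xQ.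
      by rewrite add0r lerDl divr_ge0 ?sqr_ge0.
    case: (leP (circ_dist _) d) => hd /=; first by rewrite -addrA lerDl add0r divr_ge0 ?sqr_ge0.
    rewrite !add0r ler_pdivlMr ?exprn_gt0 // mul1r.
    by apply: lerXn2r; rewrite ?nnegrE ?circ_dist_ge0 ?ltW.
  apply: lerD; last by rewrite ler_pM2r ?invr_gt0 ?exprn_gt0 // ltW.
  rewrite lerD2l natr1 ler_nat.
  by rewrite sum_leq_minn geq_minr.
have hch := prime_count_ge (trunc_log_ltn P (isT : 1 < 2)%N); rewrite -/l in hch.
have tt : `|t| <= pi.
  by rewrite ger0_norm //; apply: le_trans t1; rewrite !(divr_ge0, exprn_ge0) // ltW.
have Qw : Q%:R <= w by apply: le_trans KQ; rewrite ler_peMl // (le_trans _ K1) // (ler_nat _ 1).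
have wP1 : w <= P%:R.
  by rewrite -wP -[leLHS]expr1 ler_weXn2l.
have key j : (j.+2 <= H)%N -> K%:R * (Q%:R ^+ j.+1 * w) / w ^+ H <= w ^+ j.+2 / w ^+ H.
  move=> jH; rewrite ler_pM2r ?invr_gt0 // [Q%:R ^+ _]exprS !mulrA [leRHS]exprSr ler_pM2r //.
  rewrite [leRHS]exprS; apply: ler_pM => //.
  by apply: lerXn2r; rewrite ?nnegrE // ltW.
have e2 : (2 : R) ^+ (2 * k + 5) = 2 ^+ k * 2 ^+ k * 32.
  by rewrite exprD mulnC exprM expr2 -!natrX //; congr (_ * _); rewrite natrX.
have hkap : (2 * Q%:R) ^+ k * (6 * Q%:R * (2 ^+ k * d)) = (24 / 32) * (K%:R * (Q%:R ^+ k.+1 * w) / w ^+ H).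
  by rewrite Kk e2 /d exprMn exprS; field; rewrite gt_eqF.
have kap : (2 * Q%:R) ^+ k * (6 * Q%:R * (2 ^+ k * d)) <= (24 / 32) * (w ^+ k.+2 / w ^+ H).
  by rewrite hkap ler_pM2l // key // (leq_trans _ kH) // -addn2 leq_add2l.
have := @norm_le_of_prime_powers R k P (8 * l) A t d k0; rewrite -/Q.
move=> /(_ isT) H1.
have : P%:R ^+ k * `|t| <= (2 * Q%:R) ^+ k * (6 * Q%:R * (2 ^+ k * d)).
  apply: H1 => //.
  - by rewrite -(ler_nat R) (le_trans Qw).
  - rewrite -(ler_nat R) -natr1 !natrM.
    apply: (count_arith Pr l1 Q1 K1 KQ Kl _ _ cnt).
      by rewrite -wP ler_weXn2l.
    by rewrite -!natrM natr1 ler_nat; exact: leq_of_half.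
  - have kH3 : (3 <= H)%N by apply: leq_trans kH; rewrite addnC.
    have e : 2 ^+ k * (6 * Q%:R ^+ 2 * (2 ^+ k * d)) = (24 / 32) * (K%:R * (Q%:R ^+ 2 * w) / w ^+ H).
      by rewrite Kk e2 /d; field; rewrite gt_eqF.
    have h := le_trans (key 1%N kH3) (wH 3 kH3); rewrite [leLHS]e.
    by apply: (@le_trans _ _ (24 / 32 * 1)); [rewrite ler_pM2l | rewrite mulr1 (le_trans (ltW c1)) // ler1n].
  - have kH2 : (2 <= H)%N by apply: leq_trans kH; rewrite addnC.
    have e : 6 * Q%:R * d * K%:R = 24 * (K%:R * (Q%:R ^+ 1 * w) / w ^+ H).
      by rewrite /d; field; rewrite gt_eqF.
    have h := le_trans (key 0%N kH2) (wH 2 kH2).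
    have h2 : 6 * Q%:R * d <= 1.
      have h3 : 6 * Q%:R * d * K%:R <= 24 by rewrite e -[leRHS]mulr1 ler_pM2l.
      by rewrite -(ler_pM2r (_ : 0 < K%:R)); lra.
    have kH4 : (k.+2 <= H)%N by rewrite (leq_trans _ kH) // -addn2 leq_add2l.
    have := wH _ kH4; move: kap h2; lra.
move=> h; have := le_trans h kap; apply/negP; rewrite -ltNge.
apply: (@lt_le_trans _ _ (w ^+ (k + 3) / w ^+ H)).
  by rewrite mulrA ltr_pM2r ?invr_gt0 // addn3 [ltRHS]exprS ltr_pM2r ?exprn_gt0 // (lt_le_trans c1).
rewrite [leRHS]mulrC -ler_pdivrMr; last by rewrite exprn_gt0 // (lt_le_trans _ Pr).
by rewrite (le_trans t1) // ler_norm.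
Qed.

(** * Characteristic function of the geometric law *)

Definition expi {R : realType} (x : R) : R[i] := Complex (cos x) (sin x).

Definition cnorm {R : realType} (z : R[i]) : R := Normc.normc z.

Lemma expi0 (R : realType) : expi 0 = 1 :> R[i].
Proof. by rewrite /expi cos0 sin0. Qed.

Lemma expiD (R : realType) (x y : R) : expi (x + y) = expi x * expi y.
Proof. by rewrite /expi cosD sinD; simpc; congr Complex; rewrite addrC. Qed.

Lemma expiX (R : realType) (x : R) n : expi x ^+ n = expi (n%:R * x).
Proof.
elim: n => [|n IH]; first by rewrite mul0r expi0.
by rewrite exprS IH -expiD -natr1; congr expi; ring.
Qed.

Lemma expi_sum (R : realType) (I : Type) (r : seq I) (P : pred I) (F : I -> R) :
  expi (\sum_(i <- r | P i) F i) = \prod_(i <- r | P i) expi (F i).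
Proof. by apply: (big_morph expi (@expiD R) (expi0 R)). Qed.

Lemma cnormM (R : realType) (x y : R[i]) : cnorm (x * y) = cnorm x * cnorm y.
Proof. exact: Normc.normcM. Qed.

Lemma cnormD (R : realType) (x y : R[i]) : cnorm (x + y) <= cnorm x + cnorm y.
Proof. exact: le_normcD. Qed.

Lemma cnormN (R : realType) (x : R[i]) : cnorm (- x) = cnorm x.
Proof. exact: normcN. Qed.

Lemma cnorm_ge0 (R : realType) (x : R[i]) : 0 <= cnorm x.
Proof. by case: x => a b; exact: sqrtr_ge0. Qed.

Lemma cnorm_real (R : realType) (x : R) : cnorm x%:C%C = `|x|.
Proof. by rewrite /cnorm /= expr0n /= addr0 sqrtr_sqr. Qed.

Lemma cnorm_expi (R : realType) (x : R) : cnorm (expi x) = 1.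
Proof. by rewrite /cnorm /= cos2Dsin2 sqrtr1. Qed.

Lemma cnormX (R : realType) (x : R[i]) n : cnorm (x ^+ n) = cnorm x ^+ n.
Proof.
elim: n => [|n IH]; first by rewrite !expr0 /cnorm Normc.normc1.
by rewrite !exprS cnormM IH.
Qed.

Lemma cnorm_prod (R : realType) (I : Type) (r : seq I) (P : pred I) (F : I -> R[i]) :
  cnorm (\prod_(i <- r | P i) F i) = \prod_(i <- r | P i) cnorm (F i).
Proof. by apply: (big_morph cnorm (@cnormM R)); exact: Normc.normc1. Qed.

Lemma norm_Re_le_cnorm (R : realType) (z : R[i]) : `|complex.Re z| <= cnorm z.
Proof.
case: z => a b /=; rewrite -sqrtr_sqr ler_sqrt ?addr_ge0 ?sqr_ge0 //.
by rewrite lerDl sqr_ge0.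
Qed.

Lemma cnorm_le (R : realType) (a b : R) : cnorm (Complex a b) <= `|a| + `|b|.
Proof.
rewrite /cnorm /= -(ler_pXn2r (isT : 0 < 2)%N) ?nnegrE ?sqrtr_ge0 ?addr_ge0 //.
rewrite sqr_sqrtr ?addr_ge0 ?sqr_ge0 // sqrrD !real_normK ?num_real //.
by rewrite -addrA lerD2l lerDr mulrn_wge0 // mulr_ge0.
Qed.

(** Telescoping: factors are exchanged one at a time while all the others have modulus at most 1. *)
Lemma cnorm_prodB (R : realType) (I : Type) (r : seq I) (P : pred I) (a b : I -> R[i]) :
  (forall i, P i -> cnorm (a i) <= 1) -> (forall i, P i -> cnorm (b i) <= 1) ->
  cnorm (\prod_(i <- r | P i) a i - \prod_(i <- r | P i) b i) <=
    \sum_(i <- r | P i) cnorm (a i - b i).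
Proof.
move=> ha hb; elim: r => [|i r IH].
  by rewrite !big_nil subrr -[0]/(0%:C)%C cnorm_real normr0.
rewrite !big_cons; case: ifP => // Pi.
set A := \prod_(j <- r | P j) a j in IH *; set B := \prod_(j <- r | P j) b j in IH *.
have -> : a i * A - b i * B = (a i - b i) * A + b i * (A - B) by ring.
apply: (le_trans (cnormD _ _)); rewrite !cnormM; apply: lerD.
  rewrite ler_piMr ?cnorm_ge0 // cnorm_prod.
  by apply: prodr_ile1 => j Pj; rewrite cnorm_ge0 ha.
by apply: le_trans IH; rewrite ler_piMl ?cnorm_ge0 // hb.
Qed.

(* With [r = y / (1 + y)], this is [(1 - r) / (1 - r * expi th)], the characteristic function of the geometric law of mean [y]. *)
Definition geom_cf {R : realType} (y th : R) : R[i] :=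
  ((1 + y)%:C%C - y%:C%C * expi th)^-1.

Lemma cnorm_geom_den (R : realType) (y th : R) :
  cnorm ((1 + y)%:C%C - y%:C%C * expi th) = Num.sqrt (1 + 2 * (y * (1 + y)) * (1 - cos th)).
Proof.
rewrite /cnorm /expi; simpc => /=; congr Num.sqrt.
rewrite [RHS](_ : _ = (1 + y) ^+ 2 - 2 * y * (1 + y) * cos th + y ^+ 2 * (cos th ^+ 2 + sin th ^+ 2)).
  by ring.
by rewrite cos2Dsin2; ring.
Qed.

Lemma cnorm_geom_den_ge1 (R : realType) (y th : R) : 0 <= y ->
  1 <= cnorm ((1 + y)%:C%C - y%:C%C * expi th).
Proof.
move=> y0; rewrite cnorm_geom_den -[leLHS]sqrtr1 ler_wsqrtr // lerDl.
by rewrite mulr_ge0 ?subr_ge0 ?cos_le1 ?mulr_ge0 ?addr_ge0.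
Qed.

Lemma cnorm_geom_cf (R : realType) (y th : R) :
  cnorm (geom_cf y th) = (cnorm ((1 + y)%:C%C - y%:C%C * expi th))^-1.
Proof. exact: Normc.normcV. Qed.

Lemma cnorm_geom_cf_le1 (R : realType) (y th : R) : 0 <= y -> cnorm (geom_cf y th) <= 1.
Proof.
move=> y0; rewrite cnorm_geom_cf invf_le1 ?cnorm_geom_den_ge1 //.
by apply: lt_le_trans (cnorm_geom_den_ge1 th y0).
Qed.

Lemma geom_den_neq0 (R : realType) (y th : R) : 0 <= y ->
  (1 + y)%:C%C - y%:C%C * expi th != 0 :> R[i].
Proof.
move=> y0; apply: contraTneq (cnorm_geom_den_ge1 th y0) => ->.
by rewrite -[0]/(0%:C)%C cnorm_real normr0 ler10.
Qed.

(** With z = [circ_dist th ^+ 2] in [0, 1], the inverse square of the modulus is 1 + 4 y (1 + y) z.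
    For y >= 1/4 it is at least 1 + z, hence at least exp(z / 3). *)
Lemma cnorm_geom_cf_decay (R : realType) (y th : R) : 4^-1 <= y ->
  cnorm (geom_cf y th) <= expR (- (circ_dist th ^+ 2 / 6)).
Proof.
move=> y1; have y0 : 0 <= y by apply: le_trans y1; rewrite invr_ge0.
rewrite cnorm_geom_cf cnorm_geom_den.
have e : 1 - cos th = 2 * circ_dist th ^+ 2 by exact: circ_dist_sqr.
have d1 : circ_dist th ^+ 2 <= 1.
  by rewrite expr_le1 ?circ_dist_ge0 // /circ_dist ler_norml sin_geN1 sin_le1.
have d0 : 0 <= circ_dist th ^+ 2 by exact: sqr_ge0.
move: e d1 d0; move: (_ ^+ 2) => z e z1 z0.
set v := 2 * (y * (1 + y)) * (1 - cos th).
have hv : z <= v by rewrite /v e; nra.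
have h1 : expR (2 * (z / 6)) <= 1 + z.
  have h2 : 1 - 2 * (z / 6) <= expR (- (2 * (z / 6))) by rewrite expR_ge1Dx.
  have z2 : 0 < 1 + z by lra.
  rewrite -[expR _]invrK -expRN -[leRHS]invrK lef_pV2 ?posrE ?expR_gt0 ?invr_gt0 //.
  apply: le_trans h2; rewrite -[leLHS]div1r ler_pdivrMr //.
  by nra.
have v0 : 0 < 1 + v by lra.
rewrite expRN lef_pV2 ?posrE ?expR_gt0 ?sqrtr_gt0 //.
rewrite -[leLHS]ger0_norm ?expR_ge0 // -sqrtr_sqr ler_wsqrtr //.
rewrite -expRM_natl; apply: (le_trans h1); lra.
Qed.

Lemma expRN_le_quad (R : realType) (s : R) : 0 <= s -> expR (- s) <= 1 - s + s ^+ 2.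
Proof.
move=> s0; rewrite expRN; apply: (@le_trans _ _ (1 + s)^-1).
  by rewrite lef_pV2 ?posrE ?expR_gt0 ?expR_ge1Dx //; lra.
rewrite -[leLHS]div1r ler_pdivrMr; last by lra.
have : 0 <= s ^+ 3 by rewrite exprn_ge0.
nra.
Qed.

(* The Gaussian has the mean and variance of the geometric law, so the Taylor expansions agree to second order. *)
Lemma geom_cf_gauss (R : realType) (y th : R) : 0 <= y -> 0 <= th ->
  cnorm (expi (- (y * th)) * geom_cf y th - (expR (- (y * (1 + y) * th ^+ 2 / 2)))%:C%C)
  <= 2 * (y * (1 + y) ^+ 2 * th ^+ 3).
Proof.
move=> y0 t0; set E := expR _.
set D := (1 + y)%:C%C - y%:C%C * expi th.
have D0 : D != 0 by exact: geom_den_neq0.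
(* Clearing the denominator is free, because [geom_cf y th] has modulus at most 1. *)
have -> : expi (- (y * th)) * geom_cf y th - E%:C%C = geom_cf y th * (expi (- (y * th)) - D * E%:C%C).
  rewrite /geom_cf -/D; field; exact: D0.
rewrite cnormM.
apply: (@le_trans _ _ (cnorm (expi (- (y * th)) - D * E%:C%C))).
  by rewrite ler_piMl ?cnorm_ge0 // cnorm_geom_cf_le1.
have -> : expi (- (y * th)) - D * E%:C%C =
    Complex (cos (y * th) - (1 + y - y * cos th) * E) (- sin (y * th) + y * sin th * E).
  rewrite /D /expi cosN sinN; simpc; congr Complex; ring.
apply: (le_trans (cnorm_le _ _)).
have a0 : 0 <= y * th by rewrite mulr_ge0.
have [c1 c2] := (cos_ge a0, cos_le_cubic a0).
have [c3 c4] := (cos_ge t0, cos_le_cubic t0).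
have [s1 s2] := (sin_le a0, sin_ge a0).
have [s3 s4] := (sin_le t0, sin_ge t0).
set s := y * (1 + y) * th ^+ 2 / 2.
have s0 : 0 <= s by rewrite !(mulr_ge0, divr_ge0, addr_ge0, exprn_ge0).
have E1 : E <= 1 by rewrite /E -/s -expR0 ler_expR oppr_le0.
have E2 : 1 - s <= E by rewrite /E -/s expR_ge1Dx.
have E3 : E <= 1 - s + s ^+ 2 by exact: expRN_le_quad.
have E0 : 0 <= E by exact: expR_ge0.
pose a := y * th ^+ 3; pose b := y ^+ 2 * th ^+ 3; pose c := y ^+ 3 * th ^+ 3.
have [a0' b0' c0'] : [/\ 0 <= a, 0 <= b & 0 <= c] by split; rewrite mulr_ge0 ?exprn_ge0.
have -> : y * (1 + y) ^+ 2 * th ^+ 3 = a + 2 * b + c by rewrite /a /b /c; ring.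
have es : y * th * s = (b + c) / 2 by rewrite /s /b /c; field.
(* The right side is s u with u = (1 + y) th. If u >= 1, E <= 1 is enough; otherwise E <= 1 - s +
   s^2 and s <= u^2 / 2 <= u. *)
have hR3 : E - 1 + s <= (a + 2 * b + c) / 2.
  pose u := (1 + y) * th.
  have u0 : 0 <= u by rewrite mulr_ge0 ?addr_ge0.
  have -> : (a + 2 * b + c) / 2 = s * u by rewrite /s /u /a /b /c; field.
  have [u1|u1] := leP 1 u.
    by apply: (@le_trans _ _ (s * 1)); [lra | rewrite ler_wpM2l].
  apply: (@le_trans _ _ (s * s)); first by rewrite -expr2; lra.
  rewrite ler_wpM2l //.
  have -> : s = u ^+ 2 / 2 - u * th / 2 by rewrite /s /u; field.
  have : 0 <= u * th by rewrite mulr_ge0.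
  nra.
have v0 : 0 <= y * (1 - cos th) by rewrite mulr_ge0 // subr_ge0 cos_le1.
have v1 : y * (1 - cos th) <= y * th.
  rewrite ler_wpM2l //; have [t2|t2] := leP th 2; first by nra.
  by have := cos_geN1 th; lra.
have v2 : y * (cos th - (1 - th ^+ 2 / 2)) <= a / 3.
  have -> : a / 3 = y * (th ^+ 3 / 3) by rewrite /a; field.
  by rewrite ler_wpM2l //; lra.
have v3 : 0 <= y * (cos th - (1 - th ^+ 2 / 2)) by rewrite mulr_ge0 // subr_ge0.
have vw : y * (1 - cos th) * (1 - E) <= (b + c) / 2.
  by rewrite -es; apply: ler_pM => //; lra.
have vw0 : 0 <= y * (1 - cos th) * (1 - E) by rewrite mulr_ge0 // subr_ge0.
have ec : (y * th) ^+ 3 = c by rewrite exprMn.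
(* The real and imaginary parts are split so that every summand has a known sign and is bounded by
   multiples of the cubic monomials a, b, c. *)
have re : cos (y * th) - (1 + y - y * cos th) * E = (cos (y * th) - (1 - (y * th) ^+ 2 / 2))
    - (E - 1 + s) + y * (cos th - (1 - th ^+ 2 / 2)) + y * (1 - cos th) * (1 - E).
  by rewrite /s; field.
have im : - sin (y * th) + y * sin th * E =
    (y * th - sin (y * th)) - y * th * (1 - E) - y * (th - sin th) * E by ring.
have w1 : y * th * (1 - E) <= (b + c) / 2 by rewrite -es ler_wpM2l //; lra.
have w0 : 0 <= y * th * (1 - E) by rewrite mulr_ge0 // subr_ge0.
have z0 : 0 <= y * (th - sin th) * E by rewrite !mulr_ge0 // subr_ge0.
have z1 : y * (th - sin th) * E <= a / 6.
  have -> : a / 6 = y * (th ^+ 3 / 6) * 1 by rewrite /a; field.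
  apply: ler_pM => //; first by rewrite mulr_ge0 // subr_ge0.
  by rewrite ler_wpM2l //; lra.
rewrite ec in c2 s2.
suff [h1 h2] : `|cos (y * th) - (1 + y - y * cos th) * E| <= a + 2 * b + c /\
    `|- sin (y * th) + y * sin th * E| <= a + 2 * b + c by lra.
rewrite re im; split; rewrite ler_norml; apply/andP; split; lra.
Qed.

(** * Partitions as polynomial coefficients *)

Definition coef_agree {R : nzRingType} (n : nat) (p q : {poly R}) : Prop :=
  forall i, (i <= n)%N -> p`_i = q`_i.

Lemma coef_agreeM (R : nzRingType) n (p p' q q' : {poly R}) :
  coef_agree n p p' -> coef_agree n q q' -> coef_agree n (p * q) (p' * q').
Proof.
move=> hp hq i i_n; rewrite !coefM; apply: eq_bigr => j _.
by rewrite hp ?hq //; apply: leq_trans i_n; [exact: leq_subr | rewrite -ltnS].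
Qed.

Lemma coef_agree_prod (R : comNzRingType) n (I : Type) (r : seq I) (P : pred I) (p q : I -> {poly R}) :
  (forall i, P i -> coef_agree n (p i) (q i)) ->
  coef_agree n (\prod_(i <- r | P i) p i) (\prod_(i <- r | P i) q i).
Proof.
move=> h; elim: r => [|i r IH]; first by rewrite !big_nil.
by rewrite !big_cons; case: ifP => // Pi; apply: coef_agreeM (h i Pi) IH.
Qed.

Definition geom_poly {R : comNzRingType} (L m : nat) : {poly R} := \sum_(0 <= j < L.+1) 'X^(j * m).

Lemma coef_agree_geom (R : comNzRingType) n L m : (0 < m)%N -> (n <= L)%N ->
  coef_agree n (geom_poly L m : {poly R}) (geom_poly n m).
Proof.
move=> m0 nL i i_n; rewrite /geom_poly (@big_cat_nat _ _ _ n.+1) //= coefD.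
rewrite [X in _ + X]coef_sum [X in _ + X]big_nat_cond [X in _ + X]big1 ?addr0 //.
move=> j /andP[/andP[nj _] _]; rewrite coefXn; case: eqP => // e.
have : (j <= j * m)%N by rewrite leq_pmulr.
by rewrite -e leqNgt (leq_ltn_trans i_n nj).
Qed.

Lemma coef_agree_geom1 (R : comNzRingType) n m : (n < m)%N ->
  coef_agree n (geom_poly n m : {poly R}) 1.
Proof.
move=> nm i i_n; rewrite /geom_poly big_nat_recl // mul0n expr0 coefD coef_sum.
rewrite big1 ?addr0 // => j _; rewrite coefXn; case: eqP => // e.
have : (m <= j.+1 * m)%N by rewrite leq_pmull.
by rewrite -e leqNgt (leq_ltn_trans i_n nm).
Qed.

Definition part_poly {R : comNzRingType} (k M L : nat) : {poly R} :=
  \prod_(0 <= p < M | prime p) geom_poly L (p ^ k).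

Lemma part_poly_coef_full (R : comNzRingType) k n :
  (part_poly k n.+1 n : {poly R})`_n = (pPk k n)%:R.
Proof.
rewrite /part_poly /geom_poly big_mkord big_mkcond /=.
(* Zero summands encode the condition that non-primes have multiplicity 0, so expanding the product
   of sums runs over all functions and only those counted by [pPk] survive. *)
pose F (i j : 'I_n.+1) : {poly R} := if ~~ prime i ==> (j == ord0) then 'X^(j * i ^ k) else 0.
rewrite (eq_bigr (fun i => \sum_(j < n.+1) F i j)); last first.
  move=> i _; rewrite /F; case: ifP => pi /=; first by rewrite big_mkord.
  rewrite (bigD1 ord0) //= mul0n expr0 big1 ?addr0 // => j.
  by move=> /negbTE ->.
rewrite bigA_distr_bigA /= coef_sum /pPk -sum1_card natr_sum [RHS]big_mkcond /=.
apply: eq_bigr => f _; rewrite inE.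
case: (boolP [forall i : 'I_n.+1, ~~ prime i ==> (f i == ord0)]) => [/forallP h|].
  rewrite (eq_bigr (fun i : 'I_n.+1 => 'X^(f i * i ^ k))); last by move=> i _; rewrite /F h.
  rewrite -(big_morph _ (fun a b => exprD _ a b) (expr0 _)) coefXn eq_sym /=.
  by case: eqP.
rewrite negb_forall => /existsP[i hi]; rewrite (bigD1 i) //= /F (negbTE hi) mul0r coef0.
by [].
Qed.

(** Primes p > n and multiplicities above n only affect degrees above n, because p^k >= p. This
    independence of M and L allows the later passage to the limit. *)
Lemma part_poly_coef (R : comNzRingType) k n M L : (0 < k)%N -> (n < M)%N -> (n <= L)%N ->
  (part_poly k M L : {poly R})`_n = (pPk k n)%:R.
Proof.
move=> k0 nM nL; rewrite -part_poly_coef_full.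
rewrite [in RHS]/part_poly -[in RHS](mulr1 (\prod_(_ <= _ < _ | _) _)).
rewrite /part_poly (@big_cat_nat _ _ _ n.+1) //=.
apply: coef_agreeM (leqnn n).
  by apply: coef_agree_prod => p pp; apply: coef_agree_geom => //; rewrite expn_gt0 prime_gt0.
rewrite big_nat_cond.
suff : coef_agree n (\prod_(n.+1 <= p < M | (n < p < M)%N && prime p) geom_poly L (p ^ k) : {poly R})
    (\prod_(n.+1 <= p < M | (n < p < M)%N && prime p) 1) by rewrite big1_eq.
apply: coef_agree_prod => p /andP[/andP[np _] pp] i i_n.
rewrite (coef_agree_geom _ _ nL) ?expn_gt0 ?prime_gt0 //.
apply: coef_agree_geom1 => //; apply: leq_trans np _.
by rewrite -{1}[p]expn1 leq_pexp2l // prime_gt0.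
Qed.

Local Open Scope classical_set_scope.

(** * Fourier coefficients against a Gaussian *)

Lemma sin_natpi (R : realType) n : sin (n%:R * pi) = 0 :> R.
Proof.
elim: n => [|n IH]; first by rewrite mul0r sin0.
by rewrite -natr1 mulrDl mul1r sinDpi IH oppr0.
Qed.

Lemma integrable_cos_itv (R : realType) (a : R) :
  (@lebesgue_measure R).-integrable `[- pi, pi] (EFin \o (fun x => cos (a * x))).
Proof.
apply: continuous_compact_integrable; first exact: segment_compact.
apply: continuous_subspaceT => x.
apply: (@continuous_comp _ _ _ (fun x => a * x) cos); last exact: continuous_cos.
exact: mulrl_continuous.
Qed.

Lemma Rintegral_cos_diff (R : realType) (m n : nat) :
  (\int[@lebesgue_measure R]_(x in `[- pi, pi]) cos ((m%:R - n%:R) * x)) =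
  (if m == n then 2 * pi else 0) :> R.
Proof.
have pi0 := pi_gt0 R.
have Npi : - pi < pi :> R by rewrite gtrN.
case: eqP => [->|/eqP mn].
  rewrite (@eq_Rintegral _ _ _ _ _ (fun=> 1)); last by move=> x _; rewrite subrr mul0r cos0.
  rewrite Rintegral_cst //= lebesgue_measure_itv /= lte_fin Npi mul1r -EFinB /=; ring.
set a : R := m%:R - n%:R.
have a0 : a != 0 by rewrite subr_eq0 eqr_nat.
have dF (x : R) : is_derive x (1 : R) (fun x => sin (a * x) / a) (cos (a * x)).
  have h : is_derive x (1 : R) (fun x => a * x) a.
    by apply: is_derive_eq; rewrite /GRing.scale /= mulr1.
  apply: is_derive_eq; rewrite /GRing.scale /=.
  by field.
rewrite /Rintegral (@continuous_FTC2 _ _ (fun x => sin (a * x) / a)) //=.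
- have h : sin (a * pi) = 0 by rewrite mulrBl sinB !sin_natpi mul0r mulr0 subrr.
  by rewrite mulrN sinN h oppr0 mul0r subrr.
- apply: continuous_subspaceT => x.
  apply: (@continuous_comp _ _ _ (fun x => a * x) cos); last exact: continuous_cos.
  exact: mulrl_continuous.
- have cF : continuous (fun x => sin (a * x) / a).
    by move=> x; apply: differentiable_continuous; apply/derivable1_diffP; apply: ex_derive.
  split.
  + by move=> x _; apply: ex_derive.
  + exact/cvg_at_right_filter/cF.
  + exact/cvg_at_left_filter/cF.
- by move=> x _; rewrite derive1E derive_val.
Qed.

(** Real part of exp(-i n x) times the generating polynomial at exp(i x): for real coefficients the
    cosines already recover c n, and all integrals stay real. *)
Definition trig_sum {R : realType} (c : nat -> R) (S n : nat) (x : R) : R :=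
  \sum_(0 <= m < S) c m * cos ((m%:R - n%:R) * x).

Lemma integrable_trig_sum (R : realType) (c : nat -> R) S n :
  (@lebesgue_measure R).-integrable `[- pi, pi] (EFin \o trig_sum c S n).
Proof.
elim: S => [|S IH].
  rewrite (_ : _ \o _ = cst 0%E); first exact: integrable0.
  by apply/funext => x /=; rewrite /trig_sum big_geq.
rewrite (_ : _ \o _ = ((EFin \o trig_sum c S n) \+
    (fun x => (c S)%:E * (EFin \o (fun x => cos ((S%:R - n%:R) * x))) x))%E).
  by apply: integrableD => //; apply: integrableZl => //; exact: integrable_cos_itv.
by apply/funext => x /=; rewrite /trig_sum big_nat_recr.
Qed.

Lemma Rintegral_trig_sum (R : realType) (c : nat -> R) S n : (n < S)%N ->
  \int[@lebesgue_measure R]_(x in `[- pi, pi]) trig_sum c S n x = 2 * pi * c n.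
Proof.
move=> nS.
suff -> : \int[@lebesgue_measure R]_(x in `[- pi, pi]) trig_sum c S n x =
    \sum_(0 <= m < S) c m * (if m == n then 2 * pi else 0).
  rewrite (bigD1_seq n) ?mem_index_iota ?iota_uniq //= eqxx big1 ?addr0; first by rewrite mulrC.
  by move=> i /negbTE ->; rewrite mulr0.
elim: S {nS} => [|S IH].
  rewrite big_geq // (@eq_Rintegral _ _ _ _ _ (fun=> 0)).
    by rewrite Rintegral_cst // mul0r.
  by move=> x _; rewrite /trig_sum big_geq.
rewrite big_nat_recr //= -IH -Rintegral_cos_diff -RintegralZl //; last exact: integrable_cos_itv.
rewrite -RintegralD //; last 2 first.
- exact: integrable_trig_sum.
- rewrite (_ : _ \o _ = (fun x => (c S)%:E * (EFin \o (fun x => cos ((S%:R - n%:R) * x))) x)%E) //.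
  by apply: integrableZl => //; exact: integrable_cos_itv.
by apply: eq_Rintegral => x _; rewrite /trig_sum big_nat_recr.
Qed.

Lemma gauss_scale (R : realType) (V x : R) : 0 < V ->
  expR (- (V * x ^+ 2 / 2)) = Num.sqrt (2 * pi / V) * normal_pdf 0 (Num.sqrt V^-1) x.
Proof.
move=> V0; have pi0 := pi_gt0 R.
have s0 : Num.sqrt V^-1 != 0 by rewrite gt_eqF // sqrtr_gt0 invr_gt0.
rewrite normal_pdfE // /normal_peak /normal_fun sqr_sqrtr ?invr_ge0 ?ltW //.
rewrite (_ : V^-1 * pi *+ 2 = 2 * pi / V); last by rewrite -mulr_natl; ring.
rewrite [RHS]mulrA divff ?mul1r; last by rewrite gt_eqF // sqrtr_gt0 divr_gt0 // mulr_gt0.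
by congr expR; rewrite subr0; field; rewrite gt_eqF.
Qed.

Lemma integrable_gauss (R : realType) (V : R) : 0 < V ->
  (@lebesgue_measure R).-integrable setT (EFin \o (fun x => expR (- (V * x ^+ 2 / 2)))).
Proof.
move=> V0; rewrite (_ : _ \o _ = (fun x => (Num.sqrt (2 * pi / V))%:E *
    (normal_pdf 0 (Num.sqrt V^-1) x)%:E)%E).
  by apply: integrableZl => //; exact: integrable_normal_pdf.
by apply/funext => x /=; rewrite gauss_scale.
Qed.

Lemma Rintegral_gauss (R : realType) (V : R) : 0 < V ->
  \int[@lebesgue_measure R]_x expR (- (V * x ^+ 2 / 2)) = Num.sqrt (2 * pi / V).
Proof.
move=> V0; under eq_Rintegral do rewrite gauss_scale //.
rewrite RintegralZl //; last exact: integrable_normal_pdf.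
by rewrite /Rintegral integral_normal_pdf mulr1.
Qed.

Lemma integrable_patch (R : realType) (D : set R) (f : R -> R) : measurable D ->
  (@lebesgue_measure R).-integrable D (EFin \o f) ->
  (@lebesgue_measure R).-integrable setT (EFin \o (f \_ D)).
Proof.
by move=> mD h; rewrite -restrict_EFin; exact: (proj1 (@integrable_mkcond _ _ _ (@lebesgue_measure R) D (EFin \o f) mD)).
Qed.

Lemma integrable_cst_itv (R : realType) (a b c : R) :
  (@lebesgue_measure R).-integrable `[a, b] (EFin \o (fun=> c)).
Proof.
apply: continuous_compact_integrable; first exact: segment_compact.
by apply: continuous_subspaceT => x; exact: cst_continuous.
Qed.

Lemma Rintegral_cst_sym (R : realType) (a c : R) : 0 <= a ->
  \int[@lebesgue_measure R]_x ((fun=> c) \_ `[- a, a]) x = 2 * a * c.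
Proof.
move=> a0; rewrite -Rintegral_mkcond Rintegral_cst //= lebesgue_measure_itv /= lte_fin.
case: ifPn => [_|]; first by rewrite -EFinB /=; ring.
rewrite -leNgt => h; have -> : a = 0 by apply/eqP; rewrite eq_le a0 andbT; lra.
by rewrite /= !mulr0 mul0r.
Qed.

(** The integrals of [T] over [-pi, pi] and of the Gaussian over the line are 2 pi c n and sqrt(2 pi
    / V). Their difference is dominated by B1 on [-t0, t0], B2 on [-pi, pi], and the Gaussian tail
    beyond t0. In the tail half of the exponent is evaluated at t0, giving exp(-V t0^2 / 4); the
    other half, [G2], is kept for integrability. *)
Lemma norm_trig_coef_sub_gauss (R : realType) (c : nat -> R) (S n : nat) (V t0 B1 B2 : R) :
  (n < S)%N -> 0 < V -> 0 <= t0 <= pi -> 0 <= B1 -> 0 <= B2 ->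
  (forall t, 0 <= t <= t0 -> `|trig_sum c S n t - expR (- (V * t ^+ 2 / 2))| <= B1) ->
  (forall t, t0 <= t <= pi -> `|trig_sum c S n t| <= B2) ->
  `|c n - (Num.sqrt (2 * pi * V))^-1| <=
    t0 * B1 + B2 + 2 * expR (- (V * t0 ^+ 2 / 4)) / Num.sqrt (2 * pi * V).
Proof.
move=> nS V0 /andP[t00 t0p] B10 B20 hB1 hB2.
have pi0 := pi_gt0 R; have pi2 := pi_ge2 R.
set mu := @lebesgue_measure R.
set T := trig_sum c S n in hB1 hB2.
have Teven x : T (- x) = T x.
  by apply: eq_bigr => m _; rewrite mulrN cosN.
set G := fun x : R => expR (- (V * x ^+ 2 / 2)).
set e := expR (- (V * t0 ^+ 2 / 4)).
set G2 := fun x : R => expR (- (V / 2 * x ^+ 2 / 2)).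
have V20 : 0 < V / 2 by rewrite divr_gt0.
have Geven x : G (- x) = G x by rewrite /G sqrrN.
have G2even x : G2 (- x) = G2 x by rewrite /G2 sqrrN.
pose f x := (T \_ `[- pi, pi]) x - G x.
pose g x := (((fun _ : R => B1) \_ `[- t0, t0]) x + ((fun _ : R => B2) \_ `[- pi, pi]) x) + e * G2 x.
have GG2 x : t0 <= x -> G x <= e * G2 x.
  move=> tx; rewrite /G /e /G2 -expRD ler_expR.
  have : V * t0 ^+ 2 <= V * x ^+ 2 by rewrite ler_pM2l //; apply: lerXn2r; rewrite ?nnegrE //; lra.
  lra.
have eG2 x : 0 <= e * G2 x by rewrite mulr_ge0 ?expR_ge0.
have in_sym (a x : R) : 0 <= x -> (x \in `[- a, a]%classic) = (x <= a).
  by move=> x0; rewrite mem_setE in_itv /=; apply: andb_idl => h; lra.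
have fg0 x : 0 <= x -> `|f x| <= g x.
  move=> x0; rewrite /f /g !patchE !in_sym //.
  case: (leP x t0) => xt0.
    rewrite (le_trans xt0 t0p); have := hB1 x; rewrite x0 xt0 => /(_ isT) h.
    by apply: (le_trans h); rewrite -addrA lerDl addr_ge0.
  case: (leP x pi) => xp; last first.
    by rewrite !add0r normrN ger0_norm ?expR_ge0 // GG2 // ltW.
  rewrite add0r; apply: (le_trans (ler_normB _ _)); apply: lerD.
    by apply: hB2; rewrite xp ltW.
  by rewrite ger0_norm ?expR_ge0 // GG2 // ltW.
have itv_sym (a x : R) : (- x \in `[- a, a]%classic) = (x \in `[- a, a]%classic).
  by rewrite !mem_setE !in_itv /= lerN2 lerNl andbC.
have fg x : `|f x| <= g x.
  have [x0|x0] := leP 0 x; first exact: fg0.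
  have := fg0 (- x); rewrite oppr_ge0 ltW // => /(_ isT).
  by rewrite /f /g !patchE !itv_sym Teven Geven G2even.
pose T1 := T \_ `[- pi, pi]; pose b1 := (fun _ : R => B1) \_ `[- t0, t0].
pose b2 := (fun _ : R => B2) \_ `[- pi, pi].
have iT : mu.-integrable setT (EFin \o T1).
  by apply: integrable_patch => //; exact: integrable_trig_sum.
have iG : mu.-integrable setT (EFin \o G) by exact: integrable_gauss.
have iG2 : mu.-integrable setT (EFin \o G2) by exact: integrable_gauss.
have if_ : mu.-integrable setT (EFin \o f).
  by rewrite (_ : _ \o _ = (EFin \o T1) \- (EFin \o G))%E //; exact: integrableB.
have i1 : mu.-integrable setT (EFin \o b1).
  by apply: integrable_patch => //; exact: integrable_cst_itv.
have i2 : mu.-integrable setT (EFin \o b2).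
  by apply: integrable_patch => //; exact: integrable_cst_itv.
have i3 : mu.-integrable setT (EFin \o (fun x => e * G2 x)).
  by rewrite (_ : _ \o _ = fun x => e%:E * (EFin \o G2) x)%E //; exact: integrableZl.
have i12 : mu.-integrable setT (EFin \o (fun x => b1 x + b2 x)).
  by rewrite (_ : _ \o _ = (EFin \o b1) \+ (EFin \o b2))%E //; exact: integrableD.
have ig : mu.-integrable setT (EFin \o g).
  rewrite (_ : _ \o _ = (EFin \o (fun x => b1 x + b2 x)%R) \+ (EFin \o (fun x => e * G2 x)%R))%E //.
  exact: integrableD.
have If : \int[mu]_x f x = 2 * pi * c n - Num.sqrt (2 * pi / V).
  by rewrite RintegralB // -Rintegral_mkcond Rintegral_trig_sum // Rintegral_gauss.
have Ig : \int[mu]_x g x = 2 * t0 * B1 + 2 * pi * B2 + e * Num.sqrt (2 * pi / (V / 2)).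
  by rewrite RintegralD // RintegralD // !Rintegral_cst_sym ?(ltW pi0) // RintegralZl // Rintegral_gauss.
have main : `|2 * pi * c n - Num.sqrt (2 * pi / V)| <= 2 * t0 * B1 + 2 * pi * B2 + e * Num.sqrt (2 * pi / (V / 2)).
  rewrite -If -Ig; apply: (le_trans (le_normr_Rintegral _ if_)) => //.
  apply: le_Rintegral => //.
  rewrite (_ : _ \o _ = (abse \o (EFin \o f)))%E //.
  exact: integrable_abse.
have [s [s0 s2 sE]] : exists s, [/\ 0 < s, s ^+ 2 = 2 * pi * V & Num.sqrt (2 * pi * V) = s].
  by exists (Num.sqrt (2 * pi * V)); rewrite sqrtr_gt0 sqr_sqrtr ?ltW ?mulr_gt0.
rewrite sE.
have e1 : Num.sqrt (2 * pi / V) = 2 * pi / s.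
  move: pi0 s2; move: (pi : R) => p p0 s2.
  apply/eqP; rewrite -(eqrXn2 (isT : 0 < 2)%N) ?sqrtr_ge0 ?divr_ge0 ?invr_ge0 ?mulr_ge0 ?(ltW p0) ?(ltW V0) ?(ltW s0) ?(ltW V20) //.
  rewrite sqr_sqrtr ?divr_ge0 ?invr_ge0 ?mulr_ge0 ?(ltW p0) ?(ltW V0) ?(ltW s0) ?(ltW V20) // exprMn exprVn s2; apply/eqP.
  by field; rewrite !gt_eqF.
have e2 : Num.sqrt (2 * pi / (V / 2)) <= 2 * (2 * pi / s).
  move: pi0 s2; move: (pi : R) => p p0 s2.
  rewrite -(ler_pXn2r (isT : 0 < 2)%N) ?nnegrE ?sqrtr_ge0 ?mulr_ge0 ?divr_ge0 ?invr_ge0 ?(ltW p0) ?(ltW V0) ?(ltW s0) ?(ltW V20) //.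
  rewrite sqr_sqrtr ?divr_ge0 ?invr_ge0 ?mulr_ge0 ?(ltW p0) ?(ltW V0) ?(ltW s0) ?(ltW V20) // !exprMn exprVn s2.
  rewrite -subr_ge0 (_ : _ - _ = 4 * p / V); last by field; rewrite !gt_eqF.
  by rewrite divr_ge0 ?mulr_ge0 // ltW.
have e0 : 0 <= e by exact: expR_ge0.
have : `|2 * pi * c n - 2 * pi / s| <= 2 * t0 * B1 + 2 * pi * B2 + e * (2 * (2 * pi / s)).
  by rewrite -e1 in e2 *; apply: (le_trans main); rewrite lerD2l; exact: ler_wpM2l.
have tB : 0 <= t0 * B1 by rewrite mulr_ge0.
move: pi0 pi2; move: (pi : R) => p p0 p2 h.
rewrite -(ler_pM2l (_ : 0 < 2 * p)) ?mulr_gt0 //.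
rewrite -[X in X * `|_|]ger0_norm ?mulr_ge0 ?(ltW p0) // -normrM mulrBr; apply: (le_trans h).
rewrite -subr_ge0 [leRHS](_ : _ = (2 * p - 2) * (t0 * B1)); last by field; rewrite gt_eqF.
by rewrite mulr_ge0 //; lra.
Qed.

(** * Product of truncated geometric series *)

Lemma Re_sum (R : realType) (I : Type) (r : seq I) (P : pred I) (F : I -> R[i]) :
  complex.Re (\sum_(i <- r | P i) F i) = \sum_(i <- r | P i) complex.Re (F i).
Proof. by apply: (big_morph (@complex.Re R)) => // -[a b] [c d]. Qed.

Lemma trig_sum_horner (R : realType) (G : {poly R}) (x : R) (S n : nat) (t : R) :
  (size G <= S)%N ->
  trig_sum (fun m => G`_m * x ^+ m) S n t =
  complex.Re (expi (- (n%:R * t)) * (map_poly (real_complex R) G).[x%:C%C * expi t]).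
Proof.
move=> GS; rewrite (@horner_coef_wide _ S) ?size_map_poly //.
rewrite mulr_sumr Re_sum /trig_sum big_mkord; apply: eq_bigr => m _.
have -> : (m%:R - n%:R) * t = - (n%:R * t) + m%:R * t by ring.
rewrite [X in complex.Re X](_ : _ = (G`_m * x ^+ m)%:C%C * expi (- (n%:R * t) + m%:R * t)).
  by rewrite /expi; simpc.
rewrite coef_map /= exprMn expiX -rmorphXn /= expiD rmorphM /=; ring.
Qed.

(** The normalisation 1 - r is that of the full geometric law, so the difference with [geom_cf] is
    exactly the discarded tail. *)
Definition geom_trunc_cf {R : realType} (L : nat) (r th : R) : R[i] :=
  (1 - r)%:C%C * \sum_(0 <= j < L.+1) (r%:C%C * expi th) ^+ j.

Lemma geom_trunc_cfE (R : realType) (L : nat) (r th : R) : 0 <= r < 1 ->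
  geom_trunc_cf L r th = geom_cf (r / (1 - r)) th * (1 - (r%:C%C * expi th) ^+ L.+1).
Proof.
move=> /andP[r0 r1].
have r1' : 1 - r != 0 by rewrite subr_eq0 eq_sym lt_eqF.
have y0 : 0 <= r / (1 - r) by rewrite divr_ge0 // subr_ge0 ltW.
rewrite /geom_trunc_cf /geom_cf; set w := r%:C%C * expi th.
have D0 := geom_den_neq0 th y0.
apply: (mulfI D0); rewrite [RHS]mulrA divff // mul1r.
have -> : (1 + r / (1 - r))%:C%C - (r / (1 - r))%:C%C * expi th = ((1 - r)^-1)%:C%C * (1 - w).
  rewrite (_ : 1 + r / (1 - r) = (1 - r)^-1); last by field.
  by rewrite /w mulrC rmorphM /= mulrC [r%:C%C * _]mulrC; ring.
rewrite mulrACA -rmorphM /= mulVf // mul1r -[RHS]opprB subrX1 big_mkord; ring.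
Qed.

Lemma cnorm_geom_trunc_sub (R : realType) (L : nat) (r th : R) : 0 <= r < 1 ->
  cnorm (geom_trunc_cf L r th - geom_cf (r / (1 - r)) th) <= r ^+ L.+1.
Proof.
move=> r01; have /andP[r0 r1] := r01.
have y0 : 0 <= r / (1 - r) by rewrite divr_ge0 // subr_ge0 ltW.
rewrite geom_trunc_cfE // mulrBr mulr1 [X in cnorm X](_ : _ = - (geom_cf (r / (1 - r)) th * (r%:C%C * expi th) ^+ L.+1)); last by ring.
rewrite cnormN cnormM cnormX cnormM cnorm_expi cnorm_real mulr1 ger0_norm //.
by rewrite ler_piMl ?exprn_ge0 // cnorm_geom_cf_le1.
Qed.

Lemma cnorm_sum (R : realType) (I : Type) (r : seq I) (P : pred I) (F : I -> R[i]) :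
  cnorm (\sum_(i <- r | P i) F i) <= \sum_(i <- r | P i) cnorm (F i).
Proof.
elim/big_ind2: _ => [|x x' y y' hx hy|//]; first by rewrite -[0]/(0%:C)%C cnorm_real normr0.
by apply: (le_trans (cnormD _ _)); exact: lerD.
Qed.

Lemma cnorm_geom_trunc_le1 (R : realType) (L : nat) (r th : R) : 0 <= r < 1 ->
  cnorm (geom_trunc_cf L r th) <= 1.
Proof.
move=> /andP[r0 r1]; rewrite cnormM cnorm_real ger0_norm ?subr_ge0 ?(ltW r1) //.
apply: (@le_trans _ _ ((1 - r) * \sum_(0 <= j < L.+1) r ^+ j)).
  rewrite ler_wpM2l ?subr_ge0 ?(ltW r1) //; apply: (le_trans (cnorm_sum _ _ _)).
  by apply: ler_sum => j _; rewrite cnormX cnormM cnorm_expi cnorm_real mulr1 ger0_norm.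
by rewrite big_mkord -opprB mulNr -subrX1 opprB gerBl exprn_ge0.
Qed.

Lemma cnorm_expi_sub1 (R : realType) (x : R) : cnorm (expi x - 1) <= 2 * `|x|.
Proof.
wlog x0 : x / 0 <= x => [h|].
  have [x0|x0] := leP 0 x; first exact: h.
  have -> : expi x - 1 = - (expi x * (expi (- x) - 1)).
    by rewrite mulrBr -expiD subrr expi0; ring.
  by rewrite cnormN cnormM cnorm_expi mul1r -normrN h // oppr_ge0 ltW.
have -> : expi x - 1 = Complex (cos x - 1) (sin x) by rewrite /expi; simpc.
apply: (le_trans (cnorm_le _ _)).
rewrite [`|x|]ger0_norm //; have := cos_ge x0; have := sin_le x0; have := sin_ge x0.
have := cos_le1 x; have := cos_geN1 x; have := sin_geN1 x; have := sin_le1 x.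
move: (cos x) (sin x) => c s h1 h2 h3 h4 h5 h6 h7.
have hc : `|c - 1| <= x.
  rewrite ler0_norm; last by lra.
  by have [x2|x2] := leP x 2; [nra | lra].
have hs : `|s| <= x.
  rewrite ler_norml h6 andbT; have [x2|x2] := leP x 1; last by lra.
  have : x ^+ 3 <= x by rewrite exprS ler_piMr // exprn_ile1.
  lra.
lra.
Qed.

(* Mean of the geometric law of ratio [x ^ m]. *)
Definition geom_mean {R : realType} (x : R) (m : nat) : R := x ^+ m / (1 - x ^+ m).

Lemma expr_lt1_itv (R : realType) (x : R) m : 0 < x < 1 -> (0 < m)%N -> 0 <= x ^+ m < 1.
Proof.
by move=> /andP[x0 x1] m0; rewrite exprn_ge0 ?(ltW x0) //= exprn_ilt1 ?(ltW x0) // -lt0n.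
Qed.

Lemma geom_mean_ge0 (R : realType) (x : R) m : 0 < x < 1 -> (0 < m)%N -> 0 <= geom_mean x m.
Proof.
by move=> hx m0; have /andP[r0 r1] := expr_lt1_itv hx m0; rewrite divr_ge0 // subr_ge0 ltW.
Qed.

(** Mean of the sum of p^k G_p over p < M. The next two are its variance and the sum of the cubic
    error terms of [geom_cf_gauss]. *)
Definition prime_mean {R : realType} (k : nat) (x : R) (M : nat) : R :=
  \sum_(0 <= p < M | prime p) (p ^ k)%:R * geom_mean x (p ^ k).

Definition prime_var {R : realType} (k : nat) (x : R) (M : nat) : R :=
  \sum_(0 <= p < M | prime p) (p ^ k)%:R ^+ 2 * (geom_mean x (p ^ k) * (1 + geom_mean x (p ^ k))).

Definition prime_third {R : realType} (k : nat) (x : R) (M : nat) : R :=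
  \sum_(0 <= p < M | prime p) (p ^ k)%:R ^+ 3 * (geom_mean x (p ^ k) * (1 + geom_mean x (p ^ k)) ^+ 2).

(** At x exp(i t) each factor of [part_poly] is a geometric sum of ratio x^(p^k) exp(i p^k t), which
    1 - x^(p^k) normalises. *)
Lemma part_poly_trig_sum (R : realType) (k M L S n : nat) (x t : R) :
  let G := part_poly k M L : {poly R} in (size G <= S)%N ->
  (\prod_(0 <= p < M | prime p) (1 - x ^+ (p ^ k))) * trig_sum (fun m => G`_m * x ^+ m) S n t =
  complex.Re (expi (- (n%:R * t)) *
    \prod_(0 <= p < M | prime p) geom_trunc_cf L (x ^+ (p ^ k)) ((p ^ k)%:R * t)).
Proof.
move=> G GS; rewrite (trig_sum_horner _ _ _ GS).
have ReZ (a : R) (z : R[i]) : a * complex.Re z = complex.Re (a%:C%C * z).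
  by case: z => u v; simpc.
rewrite ReZ mulrCA; congr (complex.Re (_ * _)).
rewrite /G /part_poly !rmorph_prod /= horner_prod -big_split /=.
apply: eq_bigr => p _; rewrite /geom_trunc_cf; congr (_ * _).
rewrite /geom_poly rmorph_sum /= horner_sum; apply: eq_bigr => j _.
by rewrite map_polyXn hornerXn mulnC exprM exprMn expiX -rmorphXn.
Qed.

Lemma expRN_lip (R : realType) (a b : R) : 0 <= a -> 0 <= b -> `|expR (- a) - expR (- b)| <= `|a - b|.
Proof.
wlog ab : a b / a <= b => [h a0 b0|a0 b0].
  have [ab|/ltW ab] := leP a b; first exact: h.
  by rewrite distrC [leRHS]distrC; exact: h.
rewrite [leRHS]distrC ger0_norm; last by rewrite subr_ge0 ler_expR lerN2.
rewrite ger0_norm ?subr_ge0 //.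
have -> : expR (- b) = expR (- a) * expR (- (b - a)) by rewrite -expRD; congr expR; ring.
have h1 := expR_ge1Dx (- (b - a)); have h2 : expR (- a) <= 1 by rewrite -expR0 ler_expR oppr_le0.
have h3 := expR_ge0 (- a); have h4 : 0 <= b - a by rewrite subr_ge0.
have -> : expR (- a) - expR (- a) * expR (- (b - a)) = expR (- a) * (1 - expR (- (b - a))) by ring.
apply: (@le_trans _ _ (expR (- a) * (b - a))); first by rewrite ler_wpM2l //; lra.
by rewrite ler_piMl.
Qed.

(** * Pointwise bounds for the characteristic function *)

Section PointwiseBounds.
Variables (R : realType) (k M L n : nat) (x : R).
Hypotheses (x01 : 0 < x < 1).
Let hr p : prime p -> 0 <= x ^+ (p ^ k) < 1.
Proof. by move=> pp; rewrite expr_lt1_itv // expn_gt0 prime_gt0. Qed.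
Let hy p : prime p -> 0 <= geom_mean x (p ^ k).
Proof. by move=> pp; rewrite geom_mean_ge0 // expn_gt0 prime_gt0. Qed.

Lemma prod_geom_trunc_sub (t : R) :
  cnorm (\prod_(0 <= p < M | prime p) geom_trunc_cf L (x ^+ (p ^ k)) ((p ^ k)%:R * t)
    - \prod_(0 <= p < M | prime p) geom_cf (geom_mean x (p ^ k)) ((p ^ k)%:R * t)) <= M%:R * x ^+ L.+1.
Proof.
apply: (le_trans (cnorm_prodB _ _ _)) => [p pp|p pp|].
- by apply: cnorm_geom_trunc_le1; exact: hr.
- by apply: cnorm_geom_cf_le1; exact: hy.
have /andP[x0 x1] := x01.
apply: (@le_trans _ _ (\sum_(0 <= p < M) x ^+ L.+1)).
  rewrite big_mkcond /=; apply: ler_sum => p _; case: ifP => [pp|]; last by rewrite exprn_ge0 // ltW.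
  apply: (le_trans (cnorm_geom_trunc_sub _ _ (hr pp))).
  have rp : x ^+ (p ^ k) <= x by rewrite -[leRHS]expr1 ler_wiXn2l ?(ltW x0) ?(ltW x1) // expn_gt0 prime_gt0.
  by apply: lerXn2r; rewrite ?nnegrE ?(ltW x0) //; case/andP: (hr pp).
by rewrite sumr_const_nat subn0 mulr_natl.
Qed.

(** The finite product is centred at [prime_mean k x M] and not at n. Correcting the phase costs the
    second term; then the factors are compared with Gaussians one by one. *)
Lemma prod_geom_gauss (t : R) : 0 <= t ->
  cnorm (expi (- (n%:R * t)) * \prod_(0 <= p < M | prime p) geom_cf (geom_mean x (p ^ k)) ((p ^ k)%:R * t)
    - (expR (- (prime_var k x M * t ^+ 2 / 2)))%:C%C)
  <= 2 * (prime_third k x M * t ^+ 3) + 2 * (`|prime_mean k x M - n%:R| * t).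
Proof.
move=> t0; set A := \prod_(_ <= _ < _ | _) _; set g := (expR _)%:C%C.
pose B := \prod_(0 <= p < M | prime p) (expi (- (geom_mean x (p ^ k) * ((p ^ k)%:R * t))) * geom_cf (geom_mean x (p ^ k)) ((p ^ k)%:R * t)).
have eB : expi (- (prime_mean k x M * t)) * A = B.
  rewrite /B big_split /= -expi_sum; congr (expi _ * _).
  by rewrite /prime_mean mulr_suml -sumrN; apply: eq_bigr => p _; ring.
have eA : expi (- (n%:R * t)) * A - g = (expi ((prime_mean k x M - n%:R) * t) - 1) * B + (B - g).
  rewrite -eB mulrBl mul1r mulrA -expiD.
  by rewrite (_ : (prime_mean k x M - n%:R) * t + - (prime_mean k x M * t) = - (n%:R * t)); ring.
rewrite eA addrC; apply: (le_trans (cnormD _ _)); rewrite addrC; rewrite [leRHS]addrC; apply: lerD.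
  rewrite cnormM; apply: (@le_trans _ _ (cnorm (expi ((prime_mean k x M - n%:R) * t) - 1) * 1)).
    apply: ler_wpM2l; first exact: cnorm_ge0.
    rewrite /B cnorm_prod; apply: prodr_ile1 => p pp; rewrite cnorm_ge0 cnormM cnorm_expi mul1r.
    by apply: cnorm_geom_cf_le1; exact: hy.
  by rewrite mulr1 (le_trans (cnorm_expi_sub1 _)) // normrM (ger0_norm t0).
pose e p := expR (- (geom_mean x (p ^ k) * (1 + geom_mean x (p ^ k)) * ((p ^ k)%:R * t) ^+ 2 / 2)).
have -> : g = \prod_(0 <= p < M | prime p) (e p)%:C%C.
  rewrite -rmorph_prod /= /g -expR_sum; congr ((expR _)%:C)%C.
  rewrite /prime_var !mulr_suml -sumrN; apply: eq_bigr => p _; rewrite exprMn; ring.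
apply: (le_trans (cnorm_prodB _ _ _)) => [p pp|p pp|].
- by rewrite cnormM cnorm_expi mul1r; apply: cnorm_geom_cf_le1; exact: hy.
- rewrite cnorm_real ger0_norm ?expR_ge0 // -expR0 ler_expR oppr_le0.
  by rewrite divr_ge0 // mulr_ge0 ?sqr_ge0 // mulr_ge0 ?addr_ge0 // hy.
rewrite /prime_third mulr_suml mulr_sumr; apply: ler_sum => p pp.
apply: (le_trans (geom_cf_gauss (hy pp) (mulr_ge0 (ler0n _ _) t0))).
by rewrite exprMn le_eqVlt; apply/orP; left; apply/eqP; ring.
Qed.

(** Only primes up to P have mean at least 1/4 and contribute decay; the factors beyond P are
    bounded by 1. *)
Lemma prod_geom_decay (P : nat) (t : R) : (P < M)%N ->
  (forall p, prime p -> (p <= P)%N -> 4^-1 <= geom_mean x (p ^ k)) ->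
  cnorm (\prod_(0 <= p < M | prime p) geom_cf (geom_mean x (p ^ k)) ((p ^ k)%:R * t))
  <= expR (- ((\sum_(0 <= p < P.+1 | prime p) circ_dist ((p ^ k)%:R * t) ^+ 2) / 6)).
Proof.
move=> PM yP; rewrite cnorm_prod (@big_cat_nat _ _ _ P.+1) //.
rewrite mulr_suml -sumrN expR_sum -[leRHS]mulr1; apply: ler_pM.
- by apply: prodr_ge0 => p _; exact: cnorm_ge0.
- by apply: prodr_ge0 => p _; exact: cnorm_ge0.
- rewrite big_nat_cond [leRHS]big_nat_cond; apply: ler_prod => p /andP[/andP[_ pP] pp].
  by rewrite cnorm_ge0 cnorm_geom_cf_decay // yP.
- by apply: prodr_ile1 => p pp; rewrite cnorm_ge0; apply: cnorm_geom_cf_le1; exact: hy.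
Qed.

End PointwiseBounds.

Lemma prime_var_ge0 (R : realType) k (x : R) M : 0 < x < 1 -> 0 <= prime_var k x M.
Proof.
move=> x01; apply: sumr_ge0 => p pp.
have := geom_mean_ge0 x01 (_ : 0 < p ^ k)%N; rewrite expn_gt0 prime_gt0 // => /(_ isT) y0.
by rewrite mulr_ge0 ?sqr_ge0 // mulr_ge0 ?addr_ge0.
Qed.

(** The parameter d measures every defect due to finite M and L: in the mean, the variance and the
    discarded multiplicities. Its coefficient depends on pi alone, so d can be sent to 0. *)
Lemma pPk_trunc_bound (R : realType) (k n P M L : nat) (x V T t0 s d : R) :
  (0 < k)%N -> 0 < x < 1 -> 0 < V -> 0 <= t0 <= pi -> 0 <= d <= 1 ->
  (n < M)%N -> (P < M)%N -> (n <= L)%N ->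
  `|prime_mean k x M - n%:R| <= d -> `|prime_var k x M - V| <= d -> M%:R * x ^+ L.+1 <= d ->
  prime_third k x M <= T ->
  (forall p, prime p -> (p <= P)%N -> 4^-1 <= geom_mean x (p ^ k)) ->
  (forall t, t0 <= t <= pi ->
     s <= \sum_(0 <= p < P.+1 | prime p) circ_dist ((p ^ k)%:R * t) ^+ 2) ->
  `|(pPk k n)%:R * x ^+ n * \prod_(0 <= p < M | prime p) (1 - x ^+ (p ^ k)) - (Num.sqrt (2 * pi * V))^-1|
  <= 2 * T * t0 ^+ 4 + expR (- (s / 6)) + 2 * expR (- (V * t0 ^+ 2 / 4)) / Num.sqrt (2 * pi * V)
     + d * (2 * pi ^+ 2 + pi ^+ 3 + pi + 1).
Proof.
move=> k0 x01 V0 /andP[t00 t0p] /andP[d0 d1] nM PM nL hN hV hL hT hy hs.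
have pi0 := pi_gt0 R.
set a := \prod_(0 <= p < M | prime p) _.
pose G := part_poly k M L : {poly R}.
(* The maximum makes index n occur in the sum even if the degree of G is below n. *)
pose S := maxn (size G) n.+1.
pose c m := a * (G`_m * x ^+ m).
have cn : c n = (pPk k n)%:R * x ^+ n * a by rewrite /c /G part_poly_coef //; ring.
have cS t : trig_sum c S n t = complex.Re (expi (- (n%:R * t)) *
    \prod_(0 <= p < M | prime p) geom_trunc_cf L (x ^+ (p ^ k)) ((p ^ k)%:R * t)).
  rewrite -(@part_poly_trig_sum R k M L S) ?leq_maxl //.
  by rewrite /trig_sum mulr_sumr; apply: eq_bigr => m _; rewrite /c -!mulrA.
(* In the last bracket 2 pi comes from the mean, pi^2 from the variance and 1 from the truncation at
   L, using t <= pi. *)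
pose B1 := 2 * (T * t0 ^+ 3) + d * (2 * pi + pi ^+ 2 + 1).
pose B2 := expR (- (s / 6)) + d.
have T0 : 0 <= T.
  apply: le_trans hT; apply: sumr_ge0 => p pp.
  have := geom_mean_ge0 x01 (_ : 0 < p ^ k)%N; rewrite expn_gt0 prime_gt0 // => /(_ isT) y0.
  by rewrite mulr_ge0 ?exprn_ge0 // mulr_ge0 ?exprn_ge0 ?addr_ge0.
have dpi : 0 <= d * (2 * pi + pi ^+ 2 + 1).
  by rewrite mulr_ge0 // !addr_ge0 // ?mulr_ge0 ?exprn_ge0 // ltW.
have hB1 t : 0 <= t <= t0 -> `|trig_sum c S n t - expR (- (V * t ^+ 2 / 2))| <= B1.
  move=> /andP[t1 t2]; have tpi := le_trans t2 t0p.
  set g := expR (- (prime_var k x M * t ^+ 2 / 2)).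
  have h1 : `|trig_sum c S n t - g| <= 2 * (T * t0 ^+ 3) + 2 * (d * pi) + d.
    rewrite cS; set A := \prod_(_ <= _ < _ | _) _.
    set A' := \prod_(0 <= p < M | prime p) geom_cf (geom_mean x (p ^ k)) ((p ^ k)%:R * t).
    have -> : complex.Re (expi (- (n%:R * t)) * A) - g = complex.Re (expi (- (n%:R * t)) * A - g%:C%C).
      by case: (_ * A) => u v.
    apply: (le_trans (norm_Re_le_cnorm _)).
    have -> : expi (- (n%:R * t)) * A - g%:C%C =
       (expi (- (n%:R * t)) * A' - g%:C%C) + expi (- (n%:R * t)) * (A - A') by ring.
    apply: (le_trans (cnormD _ _)); apply: lerD; last first.
      by rewrite cnormM cnorm_expi mul1r; apply: (le_trans (prod_geom_trunc_sub _ _ _ x01 _)).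
    apply: (le_trans (prod_geom_gauss _ _ _ x01 t1)); apply: lerD; rewrite ler_pM2l //.
      apply: ler_pM => //; last by apply: lerXn2r.
      - apply: sumr_ge0 => p pp.
        have := geom_mean_ge0 x01 (_ : 0 < p ^ k)%N; rewrite expn_gt0 prime_gt0 // => /(_ isT) y0.
        by rewrite mulr_ge0 ?exprn_ge0 // mulr_ge0 ?exprn_ge0 ?addr_ge0.
      - by rewrite exprn_ge0.
    by apply: ler_pM.
  have h2 : `|g - expR (- (V * t ^+ 2 / 2))| <= d * pi ^+ 2.
    apply: (le_trans (expRN_lip _ _)).
    - by rewrite divr_ge0 // mulr_ge0 ?sqr_ge0 // prime_var_ge0.
    - by rewrite divr_ge0 // mulr_ge0 ?sqr_ge0 // ltW.
    rewrite -mulrBl -mulrBl normrM normrM (ger0_norm (sqr_ge0 t)) [X in _ * X <= _]ger0_norm ?invr_ge0 //.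
    have h : `|prime_var k x M - V| * t ^+ 2 <= d * pi ^+ 2.
      by apply: ler_pM => //; rewrite ?sqr_ge0 //; apply: lerXn2r; rewrite ?nnegrE // ltW.
    apply: le_trans h; rewrite ler_piMr ?mulr_ge0 ?sqr_ge0 //; lra.
  have -> : trig_sum c S n t - expR (- (V * t ^+ 2 / 2)) =
    (trig_sum c S n t - g) + (g - expR (- (V * t ^+ 2 / 2))) by ring.
  apply: (le_trans (ler_normD _ _)); apply: (le_trans (lerD h1 h2)).
  rewrite /B1; move: (pi : R) => p; lra.
have hB2 t : t0 <= t <= pi -> `|trig_sum c S n t| <= B2.
  move=> tt; rewrite cS; apply: (le_trans (norm_Re_le_cnorm _)).
  rewrite cnormM cnorm_expi mul1r.
  set A := \prod_(_ <= _ < _ | _) _.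
  set A' := \prod_(0 <= p < M | prime p) geom_cf (geom_mean x (p ^ k)) ((p ^ k)%:R * t).
  have -> : A = A' + (A - A') by ring.
  apply: (le_trans (cnormD _ _)); apply: lerD; last first.
    exact: (le_trans (prod_geom_trunc_sub _ _ _ x01 _)).
  apply: (le_trans (prod_geom_decay x01 _ PM hy)); rewrite ler_expR lerN2 ler_pM2r //.
  exact: hs.
have := norm_trig_coef_sub_gauss (leq_maxr (size G) n.+1) V0 _ _ _ hB1 hB2.
rewrite t00 t0p cn => /(_ isT) h; apply: (le_trans (h _ _)).
- by rewrite addr_ge0 // mulr_ge0 // mulr_ge0 ?exprn_ge0.
- by rewrite addr_ge0 ?expR_ge0.
rewrite /B1 /B2.
have : t0 * (d * (2 * pi + pi ^+ 2 + 1)) <= pi * (d * (2 * pi + pi ^+ 2 + 1)) by rewrite ler_wpM2r.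
move: (2 * expR _ / _) (expR (- (s / 6))) => u v; move: (pi : R) => p; lra.
Qed.


Lemma pPk_local_limit (R : realType) (k n P : nat) (x V T t0 s Z : R) :
  (0 < k)%N -> 0 < x < 1 -> 0 < V -> 0 <= t0 <= pi ->
  (prime_mean k x M @[M --> \oo] --> (n%:R : R))%classic ->
  (prime_var k x M @[M --> \oo] --> V)%classic ->
  (\prod_(0 <= p < M | prime p) (1 - x ^+ (p ^ k)) @[M --> \oo] --> Z)%classic ->
  (forall M, prime_third k x M <= T) ->
  (forall p, prime p -> (p <= P)%N -> 4^-1 <= geom_mean x (p ^ k)) ->
  (forall t, t0 <= t <= pi ->
     s <= \sum_(0 <= p < P.+1 | prime p) circ_dist ((p ^ k)%:R * t) ^+ 2) ->
  `|(pPk k n)%:R * x ^+ n * Z - (Num.sqrt (2 * pi * V))^-1|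
  <= 2 * T * t0 ^+ 4 + expR (- (s / 6)) + 2 * expR (- (V * t0 ^+ 2 / 4)) / Num.sqrt (2 * pi * V).
Proof.
move=> k0 x01 V0 ht0 cN cV cZ hT hy hs; have pi0 := pi_gt0 R.
have /andP[x0 x1] := x01.
set K := (X in _ <= X); set A := (pPk k n)%:R * x ^+ n; set q := (Num.sqrt _)^-1.
pose C := 2 * pi ^+ 2 + pi ^+ 3 + pi + 1 : R.
have C0 : 0 < C.
  have posC (p : R) : 0 < p -> 0 < 2 * p ^+ 2 + p ^+ 3 + p + 1.
    by move=> p0; rewrite ltr_wpDl // addr_ge0 ?(ltW p0) // addr_ge0 ?mulr_ge0 ?exprn_ge0 ?(ltW p0).
  exact: posC.
have A0 : 0 <= A by rewrite mulr_ge0 // exprn_ge0 // ltW.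
suff h (d : R) : 0 < d -> d <= 1 -> `|A * Z - q| <= K + d * (C + A).
  apply/ler_addgt0Pr => e e0.
  have CA : 0 < C + A by rewrite ltr_pwDl.
  pose d := Num.min 1 (e / (C + A)).
  have d0 : 0 < d by rewrite lt_min ltr01 divr_gt0.
  have dd : d <= e / (C + A) by rewrite ge_min lexx orbT.
  apply: (le_trans (h d d0 _)); first by rewrite ge_min lexx.
  by rewrite lerD2l -ler_pdivlMr.
move=> d0 d1.
(* M is fixed before L, since the cost M x^(L+1) of truncating multiplicities depends on M. *)
have [M [nM PM hN hV hZ]] : exists M, [/\ (n < M)%N, (P < M)%N, `|prime_mean k x M - n%:R| <= d,
    `|prime_var k x M - V| <= d & `|\prod_(0 <= p < M | prime p) (1 - x ^+ (p ^ k)) - Z| <= d].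
  move: cN cV cZ => /cvgrPdistC_le /(_ _ d0) e1 /cvgrPdistC_le /(_ _ d0) e2 /cvgrPdistC_le /(_ _ d0) e3.
  near \oo => M; exists M; by split; near: M => //.
have [L [nL hL]] : exists L, (n <= L)%N /\ M%:R * x ^+ L.+1 <= d.
  have c0 : ((x ^+ L) @[L --> \oo] --> (0 : R))%classic by apply: cvg_expr; rewrite ger0_norm ?ltW.
  have d' : 0 < d / M%:R by rewrite divr_gt0 // ltr0n (leq_ltn_trans _ nM).
  move: c0 => /cvgr0Pnorm_le /(_ _ d') e.
  near \oo => L; exists L; split; first by near: L; exact: nbhs_infty_ge.
  rewrite mulrC -ler_pdivlMr ?ltr0n ?(leq_ltn_trans _ nM) //.
  apply: (@le_trans _ _ (x ^+ L)); first by rewrite exprS ler_piMl ?exprn_ge0 // ltW.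
  by rewrite -[leLHS]ger0_norm ?exprn_ge0 ?(ltW x0) //; near: L.
have h := @pPk_trunc_bound R k n P M L x V T t0 s d k0 x01 V0 ht0 _ nM PM nL hN hV hL (hT M) hy hs.
rewrite (ltW d0) d1 in h; move: (h isT); rewrite -/A -/q -/K -/C => {}h.
set a := \prod_(_ <= _ < _ | _) _ in hZ h.
have -> : A * Z - q = (A * a - q) - A * (a - Z) by ring.
apply: (le_trans (ler_normB _ _)); rewrite [leRHS](_ : _ = K + d * C + d * A); last by ring.
apply: lerD => //.
by rewrite normrM (ger0_norm A0) mulrC ler_wpM2r.
Unshelve. all: by end_near.
Qed.

(** * Power series and iterated sums *)

Lemma ubound_is_cvgn (R : realType) (u : nat -> R) (B : R) :
  nondecreasing_seq u -> (forall n, u n <= B) -> cvgn u.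
Proof. by move=> nu uB; apply: nondecreasing_is_cvgn => //; exists B => _ [n _ <-]. Qed.

Lemma nondecreasing_partial_sum (R : realType) (a : nat -> R) :
  (forall j, 0 <= a j) -> nondecreasing_seq (fun n => \sum_(0 <= j < n) a j).
Proof.
move=> a0; apply/nondecreasing_seqP => n; rewrite big_nat_recr //=.
by rewrite lerDl.
Qed.

Lemma cvg_sum_nat (R : realType) (f : nat -> nat -> R) (l : nat -> R) J :
  (forall j, f j @ \oo --> l j) ->
  (fun M => \sum_(0 <= j < J) f j M) @ \oo --> \sum_(0 <= j < J) l j.
Proof.
move=> fl; elim: J => [|J IH].
  rewrite big_geq // (_ : (fun M => _) = fun=> 0); first exact: cvg_cst.
  by apply/funext => M; rewrite big_geq.
rewrite big_nat_recr //= (_ : (fun M => _) = fun M => \sum_(0 <= j < J) f j M + f J M).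
  exact: cvgD.
by apply/funext => M; rewrite big_nat_recr.
Qed.

(** Tonelli for nonnegative terms, where u is an increasing exhaustion interleaved with rectangles.
    The comparison is symmetric in j and m, so it serves both orders of summation. *)
Lemma cvg_iterated_sum (R : realType) (a : nat -> nat -> R) (u : nat -> R) (l : R) :
  (forall j m, 0 <= a j m) -> nondecreasing_seq u -> u @ \oo --> l ->
  (forall N, exists N', u N <= \sum_(0 <= j < N') \sum_(0 <= m < N') a j m) ->
  (forall J M, exists N, \sum_(0 <= j < J) \sum_(0 <= m < M) a j m <= u N) ->
  (forall j, cvgn (fun M => \sum_(0 <= m < M) a j m)) /\
  (fun J => \sum_(0 <= j < J) limn (fun M => \sum_(0 <= m < M) a j m)) @ \oo --> l.
Proof.
move=> a0 nu ul h1 h2.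
have ule n : u n <= l by rewrite -(cvg_lim _ ul) //; apply: nondecreasing_cvgn_le => //; exact/cvgP/ul.
have part J M : \sum_(0 <= j < J) \sum_(0 <= m < M) a j m <= l.
  by have [N hN] := h2 J M; exact: le_trans hN (ule N).
have nd j : nondecreasing_seq (fun M => \sum_(0 <= m < M) a j m).
  exact: nondecreasing_partial_sum.
have c1 j : cvgn (fun M => \sum_(0 <= m < M) a j m).
  apply: (@ubound_is_cvgn _ _ l) => // M; apply: le_trans (part j.+1 M).
  by rewrite big_nat_recr //= lerDr sumr_ge0 // => i _; rewrite sumr_ge0.
split=> //; pose b j := limn (fun M => \sum_(0 <= m < M) a j m).
have bge j M : \sum_(0 <= m < M) a j m <= b j by exact: nondecreasing_cvgn_le.
have b0 j : 0 <= b j by apply: le_trans (bge j 0%N); rewrite big_geq.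
have ble J : \sum_(0 <= j < J) b j <= l.
  have cJ : (fun M => \sum_(0 <= j < J) \sum_(0 <= m < M) a j m) @ \oo --> \sum_(0 <= j < J) b j.
    by apply: cvg_sum_nat => j; exact: c1.
  rewrite -(cvg_lim _ cJ) //; apply: limr_le; first exact/cvgP/cJ.
  by near=> M; exact: part.
have nb := nondecreasing_partial_sum b0.
have cb := ubound_is_cvgn nb ble.
suff <- : limn (fun J => \sum_(0 <= j < J) b j) = l by [].
apply/eqP; rewrite eq_le; apply/andP; split.
  by apply: limr_le => //; near=> J; exact: ble.
rewrite -(cvg_lim _ ul) //; apply: limr_le; first exact/cvgP/ul.
near=> N; have [N' hN] := h1 N; apply: (le_trans hN).
apply: le_trans (nondecreasing_cvgn_le nb cb N').
by apply: ler_sum => j _.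
Unshelve. all: by end_near.
Qed.

(* Coefficient sequences whose power series has radius of convergence at least 1. *)
Definition geo_bounded {R : realType} (f : nat -> R) : Prop :=
  forall q, 0 < q < 1 -> exists B, forall n, `|f n| * q ^+ n <= B.

Lemma natr_expr_le (R : realType) (s : R) n : 0 <= s < 1 -> n%:R * s ^+ n <= (1 - s)^-1.
Proof.
move=> /andP[s0 s1].
have h : n%:R * s ^+ n <= \sum_(i < n) s ^+ i.
  rewrite -[n in n%:R]card_ord -sumr_const mulr_suml; apply: ler_sum => i _; rewrite mul1r.
  by rewrite ler_wiXn2l ?(ltW s1) // ltnW.
have s1' : 0 < 1 - s by rewrite subr_gt0.
apply: (le_trans h); rewrite -(ler_pM2l s1') divff ?gt_eqF //.
by rewrite -[leLHS]opprK -mulNr opprB -subrX1 opprB gerBl exprn_ge0.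
Qed.

Lemma geo_bounded_natmul (R : realType) (f : nat -> R) :
  geo_bounded f -> geo_bounded (fun n => n%:R * f n).
Proof.
(* The gap between q and the midpoint q' absorbs the factor n, as n (q / q')^n is bounded. *)
move=> hf q /andP[q0 q1]; pose q' := (1 + q) / 2.
have q'1 : 0 < q' < 1 by rewrite /q'; apply/andP; split; lra.
have [B hB] := hf _ q'1; have /andP[q'0 q'lt] := q'1.
have B0 : 0 <= B by apply: le_trans (hB 0%N); rewrite mulr_ge0 ?exprn_ge0 ?(ltW q'0).
pose s := q / q'.
have s01 : 0 <= s < 1.
  by rewrite divr_ge0 ?(ltW q0) ?(ltW q'0) //= ltr_pdivrMr // mul1r /q'; lra.
exists ((1 - s)^-1 * B) => n.
have -> : q ^+ n = s ^+ n * q' ^+ n by rewrite -exprMn divfK ?gt_eqF.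
rewrite normrM normr_nat mulrACA; apply: ler_pM => //.
- by rewrite mulr_ge0 // exprn_ge0 //; case/andP: s01.
- by rewrite mulr_ge0 // exprn_ge0 // ltW.
- exact: natr_expr_le.
Qed.

Lemma geo_bounded_shift (R : realType) (f : nat -> R) :
  geo_bounded f -> geo_bounded (fun n => f n.+1).
Proof.
move=> hf q q01; have [B hB] := hf _ q01; have /andP[q0 q1] := q01.
exists (B / q) => n; rewrite ler_pdivlMr // -mulrA -exprSr; exact: hB.
Qed.

Lemma geo_bounded_le (R : realType) (f g : nat -> R) :
  (forall n, `|f n| <= `|g n|) -> geo_bounded g -> geo_bounded f.
Proof.
move=> fg hg q q01; have [B hB] := hg _ q01; exists B => n.
by apply: le_trans (hB n); rewrite ler_wpM2r // exprn_ge0 //; case/andP: q01 => /ltW.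
Qed.

Lemma geo_bounded_diffs (R : realType) (f : nat -> R) : geo_bounded f -> geo_bounded (pseries_diffs f).
Proof. by move=> hf; apply: (geo_bounded_shift (geo_bounded_natmul hf)). Qed.

Lemma geo_bounded1 (R : realType) : geo_bounded (fun=> 1 : R).
Proof.
move=> q /andP[q0 q1]; exists 1 => n; rewrite normr1 mul1r exprn_ile1 // ltW //.
Qed.

Lemma geo_bounded_cvg (R : realType) (f : nat -> R) x :
  geo_bounded f -> 0 < x < 1 -> cvgn (pseries f x).
Proof.
move=> hf /andP[x0 x1]; pose q := (1 + x) / 2.
have q01 : 0 < q < 1 by rewrite /q; apply/andP; split; lra.
have [B hB] := hf _ q01; have /andP[q0 q1] := q01.
pose s := x / q.
have s0 : 0 <= s by rewrite divr_ge0 ?(ltW x0) ?(ltW q0).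
have s1 : s < 1 by rewrite ltr_pdivrMr // mul1r /q; lra.
have B0 : 0 <= B by apply: le_trans (hB 0%N); rewrite mulr_ge0 ?exprn_ge0 ?(ltW q0).
apply: normed_cvg; apply: (@series_le_cvg _ _ (geometric B s)) => [n|n|n|].
- exact: normr_ge0.
- by rewrite /geometric /= mulr_ge0 ?exprn_ge0.
- have e : x ^+ n = s ^+ n * q ^+ n by rewrite -exprMn divfK ?gt_eqF.
  rewrite /geometric /= e !normrM [`|s ^+ n|]ger0_norm ?exprn_ge0 // [`|q ^+ n|]ger0_norm ?exprn_ge0 ?(ltW q0) //.
  by rewrite mulrCA [B * _]mulrC ler_wpM2l // exprn_ge0.
- by apply: is_cvg_geometric_series; rewrite ger0_norm.
Qed.

(** Stated for x d, since the operator x d/dx just multiplies the n-th coefficient by n and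
    therefore iterates to [Phi2]. *)
Lemma pseries_derive (R : realType) (f : nat -> R) (x : R) : geo_bounded f -> 0 < x < 1 ->
  exists2 d, is_derive x (1 : R) (fun y => limn (pseries f y)) d &
    x * d = limn (pseries (fun n => n%:R * f n) x).
Proof.
move=> hf x01; have /andP[x0 x1] := x01.
pose K := (1 + x) / 2; have K01 : 0 < K < 1 by rewrite /K; apply/andP; split; lra.
exists (limn (pseries (pseries_diffs f) x)).
  apply: (@pseries_snd_diffs _ f K); try (apply: geo_bounded_cvg => //).
  - exact: geo_bounded_diffs.
  - by apply: geo_bounded_diffs; exact: geo_bounded_diffs.
  - by rewrite !gtr0_norm /K; lra.
have h1 : (fun n => x * pseries (pseries_diffs f) x n) @ \oo --> x * limn (pseries (pseries_diffs f) x).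
  apply: cvgM; first exact: cvg_cst.
  by have := geo_bounded_cvg (geo_bounded_diffs hf) x01.
have h2 : pseries (fun n => n%:R * f n) x @ \oo --> x * limn (pseries (pseries_diffs f) x).
  suff e : (fun n => pseries (fun n => n%:R * f n) x n.+1) = (fun n => x * pseries (pseries_diffs f) x n).
    by rewrite -cvg_shiftS /= e.
  apply/funext => n.
  rewrite /pseries /series /= big_nat_recl // mul0r mul0r add0r mulr_sumr.
  by apply: eq_bigr => i _; rewrite /pseries_diffs exprS; ring.
by rewrite (cvg_lim _ h2).
Qed.

(** * The derivatives of Phi *)

(* The coefficient of [x ^ i] in [Phi k x]. *)
Definition phi_coef {R : realType} (k i : nat) : R :=
  \sum_(0 <= j < i) \sum_(0 <= m < i.+1)
    (if prime m && ((j.+1 * m ^ k)%N == i) then j.+1%:R^-1 else 0).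

(** The weight f on degrees treats Phi, x Phi' and Phi_(2) together: take f i equal to 1, i and
    i^2. *)
Definition phi_term {R : realType} (k : nat) (f : nat -> R) (x : R) (j m : nat) : R :=
  if prime m then f (j.+1 * m ^ k)%N / j.+1%:R * x ^+ (j.+1 * m ^ k) else 0.

Lemma phi_coef_ge0 (R : realType) k i : 0 <= phi_coef k i :> R.
Proof. by apply: sumr_ge0 => j _; apply: sumr_ge0 => m _; case: ifP. Qed.

Lemma prime_expn_ge k m : (0 < k)%N -> prime m -> (m <= m ^ k)%N.
Proof. by move=> k0 pm; rewrite -{1}[m]expn1 leq_pexp2l // prime_gt0. Qed.

Lemma phi_coef_wide (R : realType) k i N : (0 < k)%N -> (i < N)%N ->
  phi_coef k i = \sum_(0 <= j < N) \sum_(0 <= m < N)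
    (if prime m && ((j.+1 * m ^ k)%N == i) then j.+1%:R^-1 else 0) :> R.
Proof.
move=> k0 iN; rewrite /phi_coef [RHS](@big_cat_nat _ _ _ i) ?(ltnW iN) //=.
have bnd j m : prime m -> (j.+1 * m ^ k)%N = i -> (j < i)%N && (m <= i)%N.
  move=> pm <-; have h := prime_expn_ge k0 pm; have m0 := prime_gt0 pm.
  by rewrite leq_pmulr ?(leq_trans m0 h) //= (leq_trans h) // leq_pmull.
rewrite [X in _ = _ + X]big_nat_cond [X in _ = _ + X]big1 ?addr0; last first.
  move=> j /andP[/andP[ij _] _]; apply: big1 => m _; case: ifP => // /andP[pm /eqP e].
  by have /andP[] := bnd _ _ pm e; rewrite ltnNge ij.
apply: eq_bigr => j _; rewrite [RHS](@big_cat_nat _ _ _ i.+1) //=.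
rewrite [X in _ = _ + X]big_nat_cond [X in _ = _ + X]big1 ?addr0 //.
move=> m /andP[/andP[im _] _]; case: ifP => // /andP[pm /eqP e].
by have /andP[_] := bnd _ _ pm e; rewrite leqNgt im.
Qed.

Lemma sum_nat_eq_ind (R : realType) (N e : nat) (c : nat -> R) :
  \sum_(0 <= i < N) (if e == i then c i else 0) = if (e < N)%N then c e else 0.
Proof.
case: ltnP => eN.
  rewrite (bigD1_seq e) ?mem_index_iota ?iota_uniq //= eqxx big1 ?addr0 // => i.
  by rewrite eq_sym => /negbTE ->.
rewrite big_nat_cond big1 // => i /andP[/andP[_ iN] _]; case: eqP => // e'.
by move: iN; rewrite -e' ltnNge eN.
Qed.

(** Partial sums run over the region (j + 1) m^k < N of a square. For large N it contains the prime
    columns of any given rectangle, as [cvg_iterated_sum] requires. *)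
Lemma phi_series_partial (R : realType) k (f : nat -> R) (x : R) N : (0 < k)%N ->
  pseries (fun i => f i * phi_coef k i) x N =
  \sum_(0 <= j < N) \sum_(0 <= m < N) (if (j.+1 * m ^ k < N)%N then phi_term k f x j m else 0).
Proof.
move=> k0; rewrite /pseries /series /=.
transitivity (\sum_(0 <= i < N) \sum_(0 <= j < N) \sum_(0 <= m < N)
    (if (j.+1 * m ^ k)%N == i then (if prime m then f i / j.+1%:R * x ^+ i else 0) else 0)).
  rewrite big_nat_cond [RHS]big_nat_cond; apply: eq_bigr => i /andP[/andP[_ iN] _].
  rewrite (phi_coef_wide _ k0 iN) mulr_sumr mulr_suml; apply: eq_bigr => j _.
  rewrite mulr_sumr mulr_suml; apply: eq_bigr => m _.
  by case: (prime m); case: eqP => _ //=; rewrite mulr0 mul0r.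
rewrite exchange_big /=; apply: eq_bigr => j _; rewrite exchange_big /=; apply: eq_bigr => m _.
by rewrite sum_nat_eq_ind.
Qed.

Lemma phi_coef_geo_bounded (R : realType) k : geo_bounded (@phi_coef R k).
Proof.
apply: (@geo_bounded_le _ _ (fun n => n%:R * n.+1%:R)) => [n|].
  rewrite ger0_norm ?phi_coef_ge0 // ger0_norm ?mulr_ge0 //.
  apply: (@le_trans _ _ (\sum_(0 <= j < n) \sum_(0 <= m < n.+1) 1)).
    apply: ler_sum => j _; apply: ler_sum => m _; case: ifP => // _.
    by rewrite invf_le1 ?ltr0n // ler1n.
  by rewrite !sumr_const_nat !subn0 mulr_natl lexx.
apply: geo_bounded_natmul.
have : geo_bounded (pseries_diffs (fun=> 1 : R)) by apply: geo_bounded_diffs; exact: geo_bounded1.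
by apply: geo_bounded_le => n; rewrite /pseries_diffs mulr1.
Qed.

Section PhiSeries.
Variables (R : realType) (k : nat).
Hypothesis k0 : (0 < k)%N.
Variables (f : nat -> R) (x : R).
Hypotheses (f0 : forall i, 0 <= f i) (fb : geo_bounded (fun i => f i * phi_coef k i)) (x01 : 0 < x < 1).

Let a0 j m : 0 <= phi_term k f x j m.
Proof.
have /andP[x0 _] := x01; rewrite /phi_term; case: ifP => // _.
by rewrite mulr_ge0 ?exprn_ge0 ?(ltW x0) // divr_ge0.
Qed.

Let u := pseries (fun i => f i * phi_coef k i) x.

Let nu : nondecreasing_seq u.
Proof.
have /andP[x0 _] := x01; apply: nondecreasing_partial_sum => i.
by rewrite mulr_ge0 ?exprn_ge0 ?(ltW x0) // mulr_ge0 ?phi_coef_ge0.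
Qed.

Let ul : u @ \oo --> limn u.
Proof. by have := geo_bounded_cvg fb x01. Qed.

Let u_le N : u N <= \sum_(0 <= j < N) \sum_(0 <= m < N) phi_term k f x j m.
Proof.
rewrite /u phi_series_partial //; apply: ler_sum => j _; apply: ler_sum => m _.
by case: ifP.
Qed.

Let u_ge J M : exists N, \sum_(0 <= j < J) \sum_(0 <= m < M) phi_term k f x j m <= u N.
Proof.
exists (J * M ^ k + J + M).+1; set N := _.+1; rewrite /u phi_series_partial //.
rewrite [leRHS](@big_cat_nat _ _ _ J) //=; last by rewrite /N; lia.
rewrite -[leLHS]addr0; apply: lerD; last first.
  by apply: sumr_ge0 => j _; apply: sumr_ge0 => m _; case: ifP.
rewrite big_nat_cond [leRHS]big_nat_cond; apply: ler_sum => j /andP[/andP[_ jJ] _].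
rewrite [leRHS](@big_cat_nat _ _ _ M) //=; last by rewrite /N; lia.
rewrite -[leLHS]addr0; apply: lerD; last by apply: sumr_ge0 => m _; case: ifP.
rewrite big_nat_cond [leRHS]big_nat_cond; apply: ler_sum => m /andP[/andP[_ mM] _].
suff -> : (j.+1 * m ^ k < N)%N by [].
have h : (j.+1 * m ^ k <= J * M ^ k)%N by apply: leq_mul => //; rewrite leq_exp2r // ltnW.
by rewrite /N ltnS -addnA (leq_trans h) // leq_addr.
Qed.

Lemma phi_series_jm :
  (fun J => \sum_(0 <= j < J) limn (fun M => \sum_(0 <= m < M) phi_term k f x j m)) @ \oo --> limn u.
Proof.
by have [] := cvg_iterated_sum a0 nu ul (fun N => ex_intro _ N (u_le N)) u_ge.
Qed.

(** With m outside, the inner sums over j are geometric and produce [prime_mean] and [prime_var];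
    the opposite order is the one defining [Phi]. *)
Lemma phi_series_mj :
  (fun M => \sum_(0 <= m < M) limn (fun J => \sum_(0 <= j < J) phi_term k f x j m)) @ \oo --> limn u.
Proof.
have h1 N : exists N', u N <= \sum_(0 <= m < N') \sum_(0 <= j < N') phi_term k f x j m.
  by exists N; rewrite exchange_big.
have h2 M J : exists N, \sum_(0 <= m < M) \sum_(0 <= j < J) phi_term k f x j m <= u N.
  by have [N hN] := u_ge J M; exists N; rewrite exchange_big.
by have [] := cvg_iterated_sum (fun m j => a0 j m) nu ul h1 h2.
Qed.

End PhiSeries.

Lemma eq_cvgn (R : realType) (u v : nat -> R) (l : R) : u =1 v -> u @ \oo --> l -> v @ \oo --> l.
Proof. by move=> /funext ->. Qed.

Lemma Phi_pseries (R : realType) k (x : R) : (0 < k)%N -> 0 < x < 1 ->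
  Phi k x = limn (pseries (@phi_coef R k) x).
Proof.
move=> k0 x01.
have e : (fun i => 1 * @phi_coef R k i) = @phi_coef R k by apply/funext => i; rewrite mul1r.
have fb : geo_bounded (fun i => 1 * @phi_coef R k i) by rewrite e; exact (@phi_coef_geo_bounded R k).
have := phi_series_jm k0 (fun=> ler01) fb x01; rewrite e => h; rewrite /Phi; apply: cvg_lim => //.
suff -> : (fun J : nat => \sum_(j < J) limn (fun M : nat => \sum_(m < M) Phi_term k x j m)) =
  (fun J => \sum_(0 <= j < J) limn (fun M => \sum_(0 <= m < M) phi_term k (fun=> 1) x j m)) by exact: h.
apply/funext => J; rewrite big_mkord; apply: eq_bigr => j _.
suff -> : (fun M : nat => \sum_(m < M) Phi_term k x j m) =
  (fun M => \sum_(0 <= m < M) phi_term k (fun=> 1) x j m) by [].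
apply/funext => M; rewrite big_mkord; apply: eq_bigr => m _.
by rewrite /Phi_term /phi_term; case: ifP => // _; rewrite mul1r mulrC.
Qed.

Lemma near_itv01 (R : realType) (x : R) : 0 < x < 1 -> \forall y \near x, 0 < y < 1.
Proof.
move=> /andP[x0 x1]; near=> y; apply/andP; split; near: y; [exact: lt_nbhsr | exact: lt_nbhsl].
Unshelve. all: by end_near.
Qed.

Lemma derive1_pseries (R : realType) (g : R -> R) (c : nat -> R) (x : R) :
  geo_bounded c -> (forall y, 0 < y < 1 -> g y = limn (pseries c y)) -> 0 < x < 1 ->
  x * derive1 g x = limn (pseries (fun n => n%:R * c n) x).
Proof.
move=> cb gE x01; have [d hd <-] := pseries_derive cb x01; congr (_ * _).
rewrite derive1E -[RHS](@derive_val _ _ _ _ _ _ _ hd); apply: near_eq_derive.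
by near=> y; apply: gE; near: y; exact: near_itv01.
Unshelve. all: by end_near.
Qed.

Lemma Phi_derive1 (R : realType) k (x : R) : (0 < k)%N -> 0 < x < 1 ->
  x * derive1 (Phi k) x = limn (pseries (fun n => n%:R * @phi_coef R k n) x).
Proof.
move=> k0 x01; apply: (derive1_pseries _ _ x01); first exact (@phi_coef_geo_bounded R k).
by move=> y y01; exact: Phi_pseries.
Qed.

Lemma Phi2_pseries (R : realType) k (x : R) : (0 < k)%N -> 0 < x < 1 ->
  Phi2 k x = limn (pseries (fun n => n%:R * (n%:R * @phi_coef R k n)) x).
Proof.
move=> k0 x01; apply: (derive1_pseries _ _ x01); first exact (geo_bounded_natmul (@phi_coef_geo_bounded R k)).
by move=> y y01; exact: Phi_derive1.
Qed.

Lemma geometric_cvg (R : realType) (r : R) : 0 <= r < 1 ->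
  (fun J => \sum_(0 <= j < J) r ^+ j.+1) @ \oo --> r / (1 - r).
Proof.
move=> /andP[r0 r1]; have := @cvg_geometric_series R r r; rewrite ger0_norm // => /(_ r1).
move=> h; apply: (eq_cvgn _ h) => J; rewrite /series /=.
by apply: eq_bigr => j _; rewrite /geometric /= exprS.
Qed.

(** The limit r / (1 - r)^2 is written y (1 + y), the variance of the geometric law of mean y. *)
Lemma geometric_deriv_cvg (R : realType) (r : R) : 0 <= r < 1 ->
  (fun J => \sum_(0 <= j < J) j.+1%:R * r ^+ j.+1) @ \oo --> r / (1 - r) * (1 + r / (1 - r)).
Proof.
move=> /andP[r0 r1]; have r1' : 1 - r != 0 by rewrite subr_eq0 eq_sym lt_eqF.
have nr : (fun J : nat => J%:R * r ^+ J) @ \oo --> (0 : R).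
  have [->|rn0] := eqVneq r 0.
    rewrite (_ : (fun J : nat => _) = fun=> 0); first exact: cvg_cst.
    by apply/funext => -[|J]; rewrite ?mul0r // exprS mul0r mulr0.
  have rr : 0 < r < 1 by rewrite lt_neqAle eq_sym rn0 r0.
  have c := geo_bounded_cvg (geo_bounded_natmul (@geo_bounded1 R)) rr.
  by apply: (eq_cvgn _ (cvg_series_cvg_0 c)) => J; rewrite /= mulr1.
have e : (fun J => \sum_(0 <= j < J) j.+1%:R * r ^+ j.+1) =
   (fun J => (1 - r)^-1 * (\sum_(0 <= j < J) r ^+ j.+1) - r / (1 - r) * (J%:R * r ^+ J)).
  apply/funext => J; elim: J => [|J IH]; first by rewrite !big_geq // mul0r !mulr0 subrr.
  by rewrite !big_nat_recr //= IH -natr1 exprS; field.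
rewrite e (_ : _ * (1 + _) = (1 - r)^-1 * (r / (1 - r)) - r / (1 - r) * 0); last by field.
apply: cvgB; apply: cvgM; try exact: cvg_cst; last exact: nr.
by apply: geometric_cvg; rewrite r0.
Qed.

Lemma prime_mean_cvg (R : realType) k (x : R) : (0 < k)%N -> 0 < x < 1 ->
  prime_mean k x @ \oo --> x * derive1 (Phi k) x.
Proof.
move=> k0 x01; rewrite Phi_derive1 //.
have := phi_series_mj k0 (fun i => ler0n R i) (geo_bounded_natmul (@phi_coef_geo_bounded R k)) x01.
move=> h; apply: (eq_cvgn _ h) => M; rewrite /prime_mean [RHS]big_mkcond /=.
apply: eq_bigr => m _; case: (boolP (prime m)) => pm; last first.
  rewrite (_ : (fun J => _) = fun=> 0); first exact: lim_cst.
  by apply/funext => J; rewrite big1 // => j _; rewrite /phi_term (negbTE pm).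
have r01 : 0 <= x ^+ (m ^ k) < 1 by apply: expr_lt1_itv => //; rewrite expn_gt0 prime_gt0.
apply: cvg_lim => //.
rewrite (_ : (fun J => _) = fun J => (m ^ k)%:R * \sum_(0 <= j < J) (x ^+ (m ^ k)) ^+ j.+1).
  by apply: cvgM; [exact: cvg_cst | exact: geometric_cvg].
apply/funext => J; rewrite mulr_sumr; apply: eq_bigr => j _.
rewrite /phi_term pm natrM [(j.+1 * _)%N]mulnC exprM; move: (_ ^+ j.+1) => z.
have : j.+1%:R != 0 :> R by rewrite pnatr_eq0.
by move: (j.+1%:R) ((m ^ k)%:R) => a b a0; field.
Qed.

Lemma prime_var_cvg (R : realType) k (x : R) : (0 < k)%N -> 0 < x < 1 ->
  prime_var k x @ \oo --> Phi2 k x.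
Proof.
move=> k0 x01; rewrite Phi2_pseries //.
have e : (fun i => (i%:R * i%:R) * @phi_coef R k i) = (fun n => n%:R * (n%:R * @phi_coef R k n)).
  by apply/funext => i; rewrite mulrA.
have fb : geo_bounded (fun i => (i%:R * i%:R) * @phi_coef R k i).
  by rewrite e; exact (geo_bounded_natmul (geo_bounded_natmul (@phi_coef_geo_bounded R k))).
have := phi_series_mj k0 (fun i => mulr_ge0 (ler0n R i) (ler0n R i)) fb x01; rewrite e.
move=> h; apply: (eq_cvgn _ h) => M; rewrite /prime_var [RHS]big_mkcond /=.
apply: eq_bigr => m _; case: (boolP (prime m)) => pm; last first.
  rewrite (_ : (fun J => _) = fun=> 0); first exact: lim_cst.
  by apply/funext => J; rewrite big1 // => j _; rewrite /phi_term (negbTE pm).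
have r01 : 0 <= x ^+ (m ^ k) < 1 by apply: expr_lt1_itv => //; rewrite expn_gt0 prime_gt0.
apply: cvg_lim => //.
rewrite (_ : (fun J => _) = fun J => (m ^ k)%:R ^+ 2 * \sum_(0 <= j < J) j.+1%:R * (x ^+ (m ^ k)) ^+ j.+1).
  by apply: cvgM; [exact: cvg_cst | exact: geometric_deriv_cvg].
apply/funext => J; rewrite mulr_sumr; apply: eq_bigr => j _.
rewrite /phi_term pm natrM [(j.+1 * _)%N]mulnC exprM; move: (_ ^+ j.+1) => z.
have : j.+1%:R != 0 :> R by rewrite pnatr_eq0.
by move: (j.+1%:R) ((m ^ k)%:R) => a b a0; field.
Qed.

(** The partial products of 1 + y_p increase and are bounded by the exponential of the sum of the
    y_p, itself at most [prime_mean], which converges. *)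
Lemma Psi_cvg (R : realType) k (x : R) : (0 < k)%N -> 0 < x < 1 ->
  0 < Psi k x /\
  (fun M => \prod_(0 <= p < M | prime p) (1 - x ^+ (p ^ k))) @ \oo --> (Psi k x)^-1.
Proof.
move=> k0 x01.
have r01 p : prime p -> 0 <= x ^+ (p ^ k) < 1.
  by move=> pp; apply: expr_lt1_itv => //; rewrite expn_gt0 prime_gt0.
have yr p : prime p -> (1 - x ^+ (p ^ k))^-1 = 1 + geom_mean x (p ^ k).
  move=> pp; have /andP[_ r1] := r01 p pp; rewrite /geom_mean.
  by field; rewrite subr_eq0 eq_sym lt_eqF.
have y0 p : prime p -> 0 <= geom_mean x (p ^ k).
  by move=> pp; rewrite geom_mean_ge0 // expn_gt0 prime_gt0.
have ub N : prime_mean k x N <= limn (prime_mean k x).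
  apply: nondecreasing_cvgn_le; last exact/cvgP/(prime_mean_cvg k0 x01).
  apply/nondecreasing_seqP => n; rewrite /prime_mean big_mkcond [leRHS]big_mkcond big_nat_recr //=.
  by rewrite lerDl; case: ifP => // pp; rewrite mulr_ge0 // y0.
pose w N := \prod_(0 <= m < N | prime m) (1 - x ^+ (m ^ k))^-1.
have wE N : w N = \prod_(0 <= m < N) (if prime m then 1 + geom_mean x (m ^ k) else 1).
  rewrite /w big_mkcond /=; apply: eq_bigr => m _; case: ifP => // pm; exact: yr.
have f1 m : 1 <= (if prime m then 1 + geom_mean x (m ^ k) else 1).
  by case: ifP => // pm; rewrite lerDl y0.
have nw : nondecreasing_seq w.
  apply/nondecreasing_seqP => n; rewrite !wE big_nat_recr //= ler_peMr //.
  by apply: prodr_ge0 => m _; apply: le_trans (f1 m).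
have w1 N : 1 <= w N.
  by have := nw 0%N N (leq0n N); rewrite {1}/w big_geq.
have bw N : w N <= expR (limn (prime_mean k x)).
  apply: (@le_trans _ _ (expR (prime_mean k x N))); last by rewrite ler_expR.
  rewrite expR_sum /w; apply: ler_prod => p pp; rewrite yr // addr_ge0 ?y0 //=.
  apply: (le_trans (expR_ge1Dx _)); rewrite ler_expR ler_peMl ?y0 // ler1n.
  by rewrite expn_gt0 prime_gt0.
have cw := ubound_is_cvgn nw bw.
have PE : Psi k x = limn w.
  rewrite /Psi; suff -> : (fun N : nat => \prod_(m < N | prime m) (1 - x ^+ (m ^ k))^-1) = w by [].
  by apply/funext => N; rewrite /w big_mkord.
have P1 : 1 <= Psi k x by rewrite PE; apply: limr_ge => //; near=> N; exact: w1.
have P0 : 0 < Psi k x by apply: lt_le_trans P1.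
split => //.
rewrite (_ : (fun M => _) = fun M => (w M)^-1).
  by apply: cvgV; [rewrite gt_eqF | rewrite PE].
by apply/funext => M; rewrite /w -prodfV; apply: eq_bigr => p _; rewrite invrK.
Unshelve. all: by end_near.
Qed.

(** * Size of the moments *)

Section PlanckFunction.
Variable R : realType.
Implicit Types t : R.

Definition planck t : R := (expR t - 1)^-1.

Lemma expR_sub1_ge t : t <= expR t - 1.
Proof. by rewrite lerBrDl expR_ge1Dx. Qed.

Lemma planck_gt0 t : 0 < t -> 0 < planck t.
Proof. by move=> t0; rewrite invr_gt0 (lt_le_trans t0) ?expR_sub1_ge. Qed.

Lemma planck_le t : 0 < t -> t * planck t <= 1.
Proof.
move=> t0; have h := expR_sub1_ge t.
by rewrite ler_pdivrMr ?mul1r // (lt_le_trans t0).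
Qed.

Lemma planck_ge t : 0 < t -> t <= 1 -> 4^-1 <= t * planck t.
Proof.
move=> t0 t1; have h := expR_sub1_ge t.
have E0 : 0 < expR t - 1 by apply: lt_le_trans h.
rewrite ler_pdivlMr // -(ler_pM2l (_ : 0 < 4)) // mulrA divff ?mul1r //.
(* The argument is halved because 1 - t vanishes at t = 1. *)
have h2 : 1 - t / 2 <= expR (- (t / 2)) by rewrite expR_ge1Dx.
have q0 : 0 < 1 - t / 2 by lra.
have h3 : expR t <= ((1 - t / 2) ^+ 2)^-1.
  rewrite -[leLHS]invrK -expRN lef_pV2 ?posrE ?expR_gt0 ?exprn_gt0 //.
  have -> : - t = 2%:R * - (t / 2) by field.
  rewrite expRM_natl; by apply: lerXn2r => //; rewrite ?nnegrE ?expR_ge0 // ltW.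
rewrite lerBlDr; apply: (le_trans h3).
rewrite -[leLHS]div1r ler_pdivrMr ?exprn_gt0 //.
by nra.
Qed.

(** Near 0 [planck t] is about 1 / t, so the product stays bounded. The decay t^(-2), from exp(t) -
    1 >= t^5 / 5!, makes sums over integers beyond P of order P. *)
Lemma planck_third : exists2 C : R, 0 < C & forall t, 0 < t ->
  t ^+ 3 * (planck t * (1 + planck t) ^+ 2) <= C /\
  (1 <= t -> t ^+ 3 * (planck t * (1 + planck t) ^+ 2) <= C / t ^+ 2).
Proof.
pose c : R := 5`!%:R; have c1 : 1 <= c by rewrite ler1n.
have big t : 1 <= t -> t ^+ 3 * (planck t * (1 + planck t) ^+ 2) <= 4 * c / t ^+ 2.
  move=> t1; have t0 : 0 < t by lra.
  have h5 : t ^+ 5 / c <= expR t - 1 by rewrite lerBrDl (expR_ge1Dxn 4) // ltW.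
  have p0 := planck_gt0 t0; have p1 := planck_le t0.
  have p2 : planck t <= c / t ^+ 5.
    rewrite -[leRHS]invrK invf_div lef_pV2 ?posrE //; last by rewrite divr_gt0 ?exprn_gt0 //; lra.
    by apply: lt_le_trans (expR_sub1_ge t).
  have p3 : planck t <= 1 by nra.
  have p4 : (1 + planck t) ^+ 2 <= 4 by nra.
  apply: (@le_trans _ _ (t ^+ 3 * (c / t ^+ 5 * 4))).
    rewrite ler_wpM2l ?exprn_ge0 ?(ltW t0) //; apply: ler_pM => //; [exact: ltW | exact: sqr_ge0].
  rewrite le_eqVlt; apply/orP; left; apply/eqP; field; rewrite !gt_eqF //.
exists (4 * c); first by lra.
move=> t t0; split; last exact: big.
have [t1|/ltW t1] := leP 1 t.
  apply: (le_trans (big t t1)); rewrite ler_pdivrMr ?exprn_gt0 // ler_peMr ?expr_ge1 //; lra.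
have p0 := planck_gt0 t0; have p1 := planck_le t0.
have -> : t ^+ 3 * (planck t * (1 + planck t) ^+ 2) = (t * planck t) * (t + t * planck t) ^+ 2 by ring.
move: p1; have : 0 < t * planck t by rewrite mulr_gt0.
move: (t * planck t) => z z0 z1.
have h : (t + z) ^+ 2 <= 4 by nra.
have h0 : 0 <= (t + z) ^+ 2 by exact: sqr_ge0.
nra.
Qed.

(** Inserting this factor bounds the first moment by the second and the second by the third. *)
Lemma planck_tD1 t : 0 < t -> 1 <= t * (1 + planck t).
Proof.
move=> t0; have E0 : 0 < expR t - 1 by apply: lt_le_trans (expR_sub1_ge t).
have h : expR t * (1 - t) <= 1.
  have := expR_ge1Dx (- t); rewrite -[X in _ -> _ <= X](expRxMexpNx_1 t) => h.
  by rewrite ler_pM2l ?expR_gt0.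
rewrite /planck -(ler_pM2r E0) mul1r; move: E0 h; move: (expR t) => E E0 h.
rewrite (_ : t * (1 + (E - 1)^-1) * (E - 1) = t * E); last by field; rewrite gt_eqF.
by lra.
Qed.

Lemma geom_mean_planck (X : R) m : 0 < X -> (0 < m)%N ->
  geom_mean (expR (- X^-1)) m = planck (m%:R / X).
Proof.
move=> X0 m0; rewrite /geom_mean /planck -expRM_natl mulrN expRN -[m%:R * X^-1]/(m%:R / X).
have t0 : 0 < m%:R / X by rewrite divr_gt0 // ltr0n.
have E1 : 1 < expR (m%:R / X) by rewrite expR_gt1.
move: E1; move: (expR _) => E E1; field.
by rewrite subr_eq0 gt_eqF //= gt_eqF //; lra.
Qed.

End PlanckFunction.

Lemma inv_sqr_sum_le (R : realFieldType) (Q M : nat) : (0 < Q)%N ->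
  \sum_(Q <= p < Q + M) (p%:R ^+ 2)^-1 <= 2 / Q%:R :> R.
Proof.
move=> Q0; have Qr : 0 < Q%:R :> R by rewrite ltr0n.
suff h : \sum_(Q <= p < Q + M) (p%:R ^+ 2)^-1 <= 2 / Q%:R - 2 / (Q + M)%:R :> R.
  by apply: (le_trans h); rewrite gerBl divr_ge0.
elim: M => [|M IH]; first by rewrite addn0 big_geq // subrr.
rewrite addnS big_nat_recr ?leq_addr //=.
have n0 : 1 <= (Q + M)%:R :> R by rewrite ler1n addn_gt0 Q0.
apply: (le_trans (lerD IH (lexx _))); move: n0; rewrite -[in (Q + M).+1%:R]natr1; move: ((Q + M)%:R) => z z1.
suff : (z ^+ 2)^-1 <= 2 / z - 2 / (z + 1) by lra.
rewrite -subr_ge0 (_ : _ - _ = (z - 1) / (z ^+ 2 * (z + 1))).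
  by rewrite divr_ge0 ?subr_ge0 // mulr_ge0 ?sqr_ge0 //; lra.
have [a b] : z != 0 /\ z + 1 != 0 by split; rewrite gt_eqF //; lra.
by field; rewrite a b.
Qed.

Lemma truncated_inv_sqr_sum_le (R : realFieldType) (Q M : nat) (b : nat -> R) (C : R) :
  (0 < Q)%N -> 0 <= C -> (forall p, 0 <= b p) -> (forall p, b p <= C) ->
  (forall p, (Q <= p)%N -> b p <= C * (Q%:R ^+ 2 / p%:R ^+ 2)) ->
  \sum_(0 <= p < M) b p <= 3 * C * Q%:R.
Proof.
move=> Q0 C0 b0 b1 b2; have Qr : 0 < Q%:R :> R by rewrite ltr0n.
apply: (@le_trans _ _ (\sum_(0 <= p < Q + M) b p)).
  rewrite [leRHS](@big_cat_nat _ _ _ M) ?leq_addl //= lerDl.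
  by apply: sumr_ge0.
rewrite (@big_cat_nat _ _ _ Q) ?leq_addr //=.
have h1 : \sum_(0 <= p < Q) b p <= C * Q%:R.
  apply: (le_trans (ler_sum _ (fun p _ => b1 p))).
  by rewrite sumr_const_nat subn0 mulr_natr.
have h2 : \sum_(Q <= p < Q + M) b p <= C * Q%:R ^+ 2 * (2 / Q%:R).
  apply: (@le_trans _ _ (\sum_(Q <= p < Q + M) C * Q%:R ^+ 2 * (p%:R ^+ 2)^-1)).
    rewrite big_nat_cond [leRHS]big_nat_cond; apply: ler_sum => p /andP[/andP[Qp _] _].
    by rewrite -mulrA b2.
  by rewrite -mulr_sumr ler_wpM2l ?inv_sqr_sum_le // mulr_ge0 ?exprn_ge0.
have e : C * Q%:R ^+ 2 * (2 / Q%:R) = 2 * (C * Q%:R) by field; rewrite gt_eqF.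
rewrite e in h2; lra.
Qed.

(** The sum is majorised over all integers: those up to P contribute O(1) each, and for p > P one
    has p^k / X >= p / (P + 1), so the tail is O(P + 1) by the decay in [planck_third]. *)
Lemma prime_moments_le (R : realType) : exists2 C : R, 0 < C & forall k P M (X : R),
  (0 < k)%N -> 0 < X -> X < (P.+1 ^ k)%:R ->
  [/\ prime_mean k (expR (- X^-1)) M <= C * X * P.+1%:R,
      prime_var k (expR (- X^-1)) M <= C * X ^+ 2 * P.+1%:R &
      prime_third k (expR (- X^-1)) M <= C * X ^+ 3 * P.+1%:R].
Proof.
have [C C0 hC] := planck_third R; exists (3 * C); first by rewrite mulr_gt0.
move=> k P M X k0 X0 XP.
pose t p : R := (p ^ k)%:R / X.
pose h (s : R) := s ^+ 3 * (planck s * (1 + planck s) ^+ 2).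
have t0 p : prime p -> 0 < t p.
  by move=> pp; rewrite divr_gt0 // ltr0n expn_gt0 prime_gt0.
have gm p : prime p -> geom_mean (expR (- X^-1)) (p ^ k) = planck (t p).
  by move=> pp; rewrite geom_mean_planck // expn_gt0 prime_gt0.
have Xt p : (p ^ k)%:R = X * t p by rewrite /t mulrC divfK // gt_eqF.
have hS : \sum_(0 <= p < M) (if prime p then h (t p) else 0) <= 3 * C * P.+1%:R.
  apply: truncated_inv_sqr_sum_le => // [|p|p|p Pp].
  - exact: ltW.
  - case: ifP => // pp; have s0 := t0 p pp; have := planck_gt0 s0.
    by rewrite /h => s1; rewrite mulr_ge0 ?exprn_ge0 ?(ltW s0) // mulr_ge0 ?sqr_ge0 ?ltW.
  - by case: ifP => [pp|_]; [have [] := hC _ (t0 p pp) | exact: ltW].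
  case: ifP => pp; last by rewrite mulr_ge0 ?(ltW C0) // divr_ge0 ?exprn_ge0.
  have Q0 : 0 < P.+1%:R :> R by rewrite ltr0n.
  have u1 : 1 <= p%:R / P.+1%:R :> R by rewrite ler_pdivlMr // mul1r ler_nat.
  have tu : p%:R / P.+1%:R <= t p.
    apply: (@le_trans _ _ ((p%:R / P.+1%:R) ^+ k)).
      by rewrite -[leLHS]expr1 ler_weXn2l.
    rewrite expr_div_n /t natrX ler_wpM2l ?exprn_ge0 // lef_pV2 ?posrE ?exprn_gt0 //.
    by rewrite -natrX ltW.
  have [_ h2] := hC _ (t0 p pp); apply: (le_trans (h2 (le_trans u1 tu))).
  rewrite ler_pM2l // -invf_div lef_pV2 ?posrE; last 2 first.
  - by rewrite exprn_gt0 // t0.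
  - by rewrite divr_gt0 ?exprn_gt0 // ltr0n prime_gt0.
  by rewrite -expr_div_n; apply: lerXn2r; rewrite ?nnegrE ?(ltW (t0 _ pp)) // (le_trans _ u1).
have hb p : prime p -> t p * planck (t p) <= t p ^+ 2 * (planck (t p) * (1 + planck (t p))) /\
    t p ^+ 2 * (planck (t p) * (1 + planck (t p))) <= h (t p).
  move=> pp; have s0 := t0 p pp; have s1 := planck_gt0 s0; have s2 := planck_tD1 s0.
  move: (t p) s0 s1 s2 => s s0 s1 s2.
  have -> : h s = s ^+ 2 * (planck s * (1 + planck s)) * (s * (1 + planck s)) by rewrite /h; ring.
  have -> : s ^+ 2 * (planck s * (1 + planck s)) = s * planck s * (s * (1 + planck s)) by ring.
  have z0 : 0 <= s * planck s by rewrite mulr_ge0 // ltW.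
  by split; rewrite ler_peMr // mulr_ge0 //; apply: le_trans s2.
have fin (F : nat -> R) (c : R) : 0 <= c -> (forall p, prime p -> F p <= c * h (t p)) ->
    \sum_(0 <= p < M | prime p) F p <= 3 * C * c * P.+1%:R.
  move=> c0 hF; rewrite big_mkcond /=.
  apply: (@le_trans _ _ (c * \sum_(0 <= p < M) (if prime p then h (t p) else 0))).
    rewrite mulr_sumr; apply: ler_sum => p _; case: ifP => pp; last by rewrite mulr0.
    exact: hF.
  by apply: (le_trans (ler_wpM2l c0 hS)); rewrite le_eqVlt; apply/orP; left; apply/eqP; ring.
split; apply: fin => [|p pp]; rewrite ?exprn_ge0 ?(ltW X0) // gm //.
- have [h1 h2] := hb p pp; rewrite Xt -mulrA ler_pM2l //; exact: le_trans h1 h2.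
- have [h1 h2] := hb p pp; rewrite Xt exprMn -mulrA ler_pM2l ?exprn_gt0 //.
- by rewrite Xt exprMn -mulrA.
Qed.

Lemma geom_mean_ge_quarter (R : realType) k P p (X : R) : 0 < X -> (P ^ k)%:R <= X -> prime p -> (p <= P)%N ->
  4^-1 <= geom_mean (expR (- X^-1)) (p ^ k) /\
  X / 4 <= (p ^ k)%:R * geom_mean (expR (- X^-1)) (p ^ k).
Proof.
move=> X0 PX pp pP; rewrite geom_mean_planck ?expn_gt0 ?prime_gt0 //.
set t := _ / X.
have t0 : 0 < t by rewrite divr_gt0 // ltr0n expn_gt0 prime_gt0.
have t1 : t <= 1.
  rewrite ler_pdivrMr // mul1r; apply: le_trans PX; rewrite ler_nat.
  by case: (posnP k) => [->|k0] //; rewrite leq_exp2r.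
have h := planck_ge t0 t1; have p0 := planck_gt0 t0; split.
  by apply: (le_trans h); rewrite ler_piMl // ltW.
have -> : (p ^ k)%:R = X * t by rewrite /t mulrC divfK // gt_eqF.
by rewrite -mulrA ler_pM2l.
Qed.

Lemma prime_var_ge (R : realType) k P M (X : R) : 0 < X -> (P ^ k)%:R <= X -> (P < M)%N ->
  X ^+ 2 / 16 * (prime_count P)%:R <= prime_var k (expR (- X^-1)) M.
Proof.
move=> X0 PX PM; rewrite /prime_var (@big_cat_nat _ _ _ P.+1) //=.
have y0 p : prime p -> 0 <= geom_mean (expR (- X^-1)) (p ^ k).
  move=> pp; apply: geom_mean_ge0; rewrite ?expn_gt0 ?prime_gt0 //.
  by rewrite expR_gt0 -expR0 ltr_expR oppr_lt0 invr_gt0.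
apply: ler_wpDr.
  by apply: sumr_ge0 => p pp; rewrite mulr_ge0 ?sqr_ge0 // mulr_ge0 ?addr_ge0 ?y0.
rewrite /prime_count natr_sum mulr_sumr [leLHS]big_nat_cond [leRHS]big_nat_cond.
apply: ler_sum => p /andP[/andP[_ pP] pp]; rewrite mulr1.
have [_ h] := geom_mean_ge_quarter X0 PX pp pP.
have g0 := y0 p pp; move: (geom_mean _ _) h g0 => y h g0.
have h2 : (X / 4) ^+ 2 <= ((p ^ k)%:R * y) ^+ 2.
  by apply: lerXn2r; rewrite ?nnegrE ?divr_ge0 ?mulr_ge0 // ltW.
have -> : X ^+ 2 / 16 = (X / 4) ^+ 2 by field.
apply: (le_trans h2); rewrite exprMn ler_wpM2l ?sqr_ge0 //.
by rewrite expr2 ler_wpM2l // lerDr.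
Qed.

(** * Assembling the error terms *)

Lemma expRN_le_inv_pow (R : realType) (a : R) (N : nat) : 0 < a ->
  exists2 C, 0 < C & forall w, 1 <= w -> expR (- (a * w)) <= C / w ^+ N.
Proof.
move=> a0; exists (N.+1`!%:R / a ^+ N.+1); first by rewrite divr_gt0 ?exprn_gt0 // ltr0n fact_gt0.
move=> w w1; have w0 : 0 < w by apply: lt_le_trans w1.
have h := expR_ge1Dxn N (ltW (mulr_gt0 a0 w0)).
have f0 : 0 < (N.+1`!)%:R :> R by rewrite ltr0n fact_gt0.
have h2 : (a * w) ^+ N.+1 / N.+1`!%:R <= expR (a * w) by apply: le_trans h; rewrite lerDr.
rewrite expRN; apply: (@le_trans _ _ (N.+1`!%:R / (a * w) ^+ N.+1)).
  by rewrite -[leRHS]invf_div lef_pV2 ?posrE ?expR_gt0 // divr_gt0 ?exprn_gt0 ?mulr_gt0.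
rewrite exprMn invfM mulrA ler_wpM2l ?divr_ge0 ?exprn_ge0 ?(ltW a0) ?(ltW f0) //.
by rewrite lef_pV2 ?posrE ?exprn_gt0 // ler_weXn2l.
Qed.

(* [D], [Y], [v], [u] stand for [P ^ k], [X / P ^ k], [sqrt P] and [w ^ (k + 3)]. *)
Lemma scaled_error_le (R : realType) (N k : nat) (C0 : R) : 0 < C0 ->
  exists2 C, 0 < C & forall w v u D Y V q : R,
  1 <= w -> 1 <= v -> w <= u -> 1 <= D -> 1 <= Y -> Y <= 2 ^+ k -> v ^+ 2 * D <= w ^+ N ->
  0 < q -> q ^+ 2 = 2 * pi * V -> V <= C0 * (Y * D) ^+ 2 * (v ^+ 2 + 1) ->
  (Y * D) ^+ 2 * v ^+ 2 <= 64 * w * V ->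
  (2 * (C0 * (Y * D) ^+ 3 * (v ^+ 2 + 1)) * (u / v / D) ^+ 4 + expR (- (w / 6)) +
    2 * expR (- (V * (u / v / D) ^+ 2 / 4)) / q) * q <= C * (u ^+ 4 / v).
Proof.
move=> C00; have pi0 := pi_gt0 R.
(* 1 + z serves as an upper bound for the square root of z = 4 pi C0. *)
pose c1 : R := 1 + 4 * pi * C0.
have a0 : 0 < 4 * pi * C0 by rewrite !mulr_gt0.
have c10 : 0 < c1 by rewrite /c1; lra.
have [C6 C60 h6] := @expRN_le_inv_pow R 6^-1 (N + N) (ltac:(by rewrite invr_gt0)).
have [C7 C70 h7] := @expRN_le_inv_pow R (64^-1 / 4) N (ltac:(by rewrite divr_gt0 ?invr_gt0)).
pose Yk : R := 2 ^+ k.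
have Yk1 : 1 <= Yk by rewrite exprn_ege1 // ler1n.
exists (4 * C0 * c1 * Yk ^+ 4 + C6 * c1 * Yk + 2 * C7).
  by rewrite !addr_gt0 // ?mulr_gt0 ?exprn_gt0 //; lra.
move=> w v u D Y V q w1 v1 uw D1 Y1 Y2 vD q0 q2 VU VL.
have w0 : 0 < w by lra. have v0 : 0 < v by lra. have u0 : 0 < u by lra.
have D0 : 0 < D by lra. have Y0 : 0 < Y by lra.
have qle : q <= c1 * (Y * D) * v.
  rewrite -(ler_pXn2r (isT : 0 < 2)%N) ?nnegrE ?(ltW q0) ?mulr_ge0 ?(ltW c10) ?(ltW Y0) ?(ltW D0) ?(ltW v0) //.
  rewrite q2; apply: (@le_trans _ _ (2 * pi * (C0 * (Y * D) ^+ 2 * (v ^+ 2 + 1)))).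
    by rewrite ler_wpM2l // mulr_ge0 // ltW.
  apply: (@le_trans _ _ (4 * pi * C0 * ((Y * D) ^+ 2 * v ^+ 2))).
    have h : 0 <= 2 * pi * C0 * (Y * D) ^+ 2 * (v ^+ 2 - 1).
      have hv : 0 <= v ^+ 2 - 1 by rewrite subr_ge0 exprn_ege1.
      by rewrite mulr_ge0 // mulr_ge0 ?sqr_ge0 // mulr_ge0 ?(ltW C00) // mulr_ge0 // ltW.
    move: h; move: (pi : R) => p; lra.
  rewrite -!exprMn -[c1 * _ * v]mulrA [leRHS]exprMn ler_wpM2r ?sqr_ge0 //.
  by rewrite /c1; move: a0; move: (4 * pi * C0) => z z0; nra.
have Yk4 : Y ^+ 4 <= Yk ^+ 4 by apply: lerXn2r; rewrite ?nnegrE ?(ltW Y0) // (le_trans _ Yk1).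
have uv0 : 0 <= u ^+ 4 / v by rewrite divr_ge0 ?exprn_ge0 ?(ltW u0) // ltW.
have v21 : v ^+ 2 + 1 <= 2 * v ^+ 2.
  have : 1 <= v ^+ 2 by rewrite exprn_ege1.
  by lra.
(* The dominant term: X^3 P t0^4 times q, of order X sqrt P, leaves Y^4 u^4 / v. *)
have main : 2 * (C0 * (Y * D) ^+ 3 * (v ^+ 2 + 1)) * (u / v / D) ^+ 4 * q
    <= 4 * C0 * c1 * Yk ^+ 4 * (u ^+ 4 / v).
  set A := 2 * _ * _ ^+ 4.
  have A0 : 0 <= A.
    apply: mulr_ge0; last by rewrite exprn_ge0 // !divr_ge0 ?(ltW u0) ?(ltW v0) ?(ltW D0).
    rewrite mulr_ge0 // mulr_ge0 ?addr_ge0 ?sqr_ge0 // mulr_ge0 ?(ltW C00) // exprn_ge0 //.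
    by rewrite mulr_ge0 // ltW.
  apply: (le_trans (ler_wpM2l A0 qle)).
  have -> : A * (c1 * (Y * D) * v) = 2 * C0 * c1 * Y ^+ 4 * (u ^+ 4 / v ^+ 3) * (v ^+ 2 + 1).
    by rewrite /A; field; rewrite !gt_eqF.
  have e : 4 * C0 * c1 * Yk ^+ 4 * (u ^+ 4 / v) = 2 * C0 * c1 * Yk ^+ 4 * (u ^+ 4 / v ^+ 3) * (2 * v ^+ 2).
    by field; rewrite gt_eqF.
  have B0 : 0 <= 2 * C0 * c1 by rewrite !mulr_ge0 ?(ltW C00) ?(ltW c10).
  have U0 : 0 <= u ^+ 4 / v ^+ 3 by rewrite divr_ge0 ?exprn_ge0 ?(ltW u0) ?(ltW v0).
  rewrite e; apply: ler_pM => //.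
  - by rewrite mulr_ge0 // mulr_ge0 // exprn_ge0 // ltW.
  - by rewrite addr_ge0 ?sqr_ge0.
  - by rewrite ler_wpM2r // ler_wpM2l.
have uv1 : v^-1 <= u ^+ 4 / v.
  by rewrite ler_peMl ?invr_ge0 ?(ltW v0) // exprn_ege1 // (le_trans w1).
have vN : v <= w ^+ N.
  apply: le_trans vD; rewrite expr2 -mulrA ler_peMr ?(ltW v0) //.
  by rewrite mulr_ege1.
have wN0 : 0 < w ^+ N by rewrite exprn_gt0.
have second : expR (- (w / 6)) * q <= C6 * c1 * Yk * (u ^+ 4 / v).
  have h := h6 w w1; rewrite mulrC in h.
  apply: (@le_trans _ _ (C6 / w ^+ (N + N) * (c1 * (Y * D) * v))).
    by apply: ler_pM; rewrite ?expR_ge0 ?(ltW q0).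
  apply: (@le_trans _ _ (C6 * c1 * Yk * v^-1)); last first.
    by rewrite ler_wpM2l // !mulr_ge0 ?(ltW C60) ?(ltW c10) // (le_trans _ Yk1).
  have -> : C6 / w ^+ (N + N) * (c1 * (Y * D) * v) = (C6 * c1) * (Y * ((v ^+ 2 * D) / w ^+ (N + N) / v)).
    by field; rewrite !gt_eqF ?exprn_gt0.
  rewrite -[leRHS]mulrA ler_wpM2l ?mulr_ge0 ?(ltW C60) ?(ltW c10) //.
  apply: ler_pM; rewrite ?(ltW Y0) //.
    by rewrite !divr_ge0 ?mulr_ge0 ?sqr_ge0 ?exprn_ge0 ?(ltW D0) ?(ltW w0) ?(ltW v0).
  rewrite ler_piMl ?invr_ge0 ?(ltW v0) // ler_pdivrMr ?exprn_gt0 // mul1r.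
  by apply: (le_trans vD); rewrite exprD ler_peMr ?(ltW wN0) // exprn_ege1.
have third : 2 * expR (- (V * (u / v / D) ^+ 2 / 4)) / q * q <= 2 * C7 * (u ^+ 4 / v).
  rewrite divfK ?gt_eqF //.
  (* The lower bound for V gives V t0^2 >= (Y u)^2 / (64 w), and u >= w. *)
  have ht : w / 64 <= V * (u / v / D) ^+ 2.
    have -> : V * (u / v / D) ^+ 2 = (64 * w * V) * (u ^+ 2 / (64 * w * (v ^+ 2 * D ^+ 2))).
      by field; rewrite !gt_eqF.
    apply: (@le_trans _ _ ((Y * D) ^+ 2 * v ^+ 2 * (u ^+ 2 / (64 * w * (v ^+ 2 * D ^+ 2))))).
      have -> : (Y * D) ^+ 2 * v ^+ 2 * (u ^+ 2 / (64 * w * (v ^+ 2 * D ^+ 2))) = (Y * u) ^+ 2 / w / 64.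
        by field; rewrite !gt_eqF.
      rewrite ler_pM2r ?invr_gt0 // ler_pdivlMr // -expr2.
      apply: lerXn2r; rewrite ?nnegrE ?mulr_ge0 ?(ltW w0) ?(ltW u0) ?(ltW Y0) //.
      by apply: (le_trans uw); rewrite ler_peMl // ltW.
    by rewrite ler_wpM2r // divr_ge0 ?mulr_ge0 ?sqr_ge0 // ltW.
  have h := h7 w w1.
  have h' : expR (- (V * (u / v / D) ^+ 2 / 4)) <= C7 / v.
    apply: (@le_trans _ _ (expR (- (64^-1 / 4 * w)))).
      by rewrite ler_expR lerN2; lra.
    apply: (le_trans h); rewrite ler_wpM2l ?(ltW C70) // lef_pV2 //.
  rewrite -[leRHS]mulrA ler_pM2l //; apply: (le_trans h').
  by rewrite ler_wpM2l ?(ltW C70).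
have := lerD (lerD main second) third.
set a := (X in X * q + _ + _); set b := expR _; set c := (X in _ + X * q <= _).
by rewrite -2!mulrDl => h; apply: (le_trans h); rewrite -2!mulrDl.
Qed.

Lemma half_double_ge P : (2 <= P)%N -> (P <= 4 * P./2)%N.
Proof. lia. Qed.

Lemma exists_nat_root (R : realType) (k : nat) (X : R) : (0 < k)%N -> 0 < X ->
  exists P, (P ^ k)%:R <= X < (P.+1 ^ k)%:R.
Proof.
move=> k0 X0; pose a p := ((p ^ k)%:R <= X).
have a0 : exists p, a p by exists 0%N; rewrite /a exp0n // ltW.
have ab p : a p -> (p <= Num.truncn X)%N.
  move=> ap; rewrite truncn_ge_nat ?(ltW X0) //; apply: le_trans ap.
  by rewrite ler_nat; case: p => // p; rewrite -{1}[p.+1]expn1 leq_pexp2l.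
have [P aP Pmax] := ex_maxnP a0 ab; exists P; rewrite [_ <= X]aP /=.
by rewrite ltNge; apply/negP => h; have := Pmax _ h; rewrite ltnn.
Qed.

Lemma exists_root (R : realType) (P : R) (m : nat) : 1 <= P -> (0 < m)%N ->
  exists2 w, 1 <= w & w ^+ m = P.
Proof.
move=> P1 m0; have P0 : 0 <= P by rewrite (le_trans _ P1).
have e : (P `^ m%:R^-1) ^+ m = P.
  by rewrite -powR_mulrn ?powR_ge0 // -powRrM mulVf ?powRr1 // pnatr_eq0 -lt0n.
exists (P `^ m%:R^-1) => //.
rewrite leNgt; apply/negP => h.
suff : (P `^ m%:R^-1) ^+ m < 1 by rewrite e ltNge P1.
by rewrite exprn_ilt1 ?powR_ge0 // -lt0n.
Qed.

Lemma inv_le_powR (R : realType) (m : nat) (n z c : R) : (0 < m)%N -> 0 < n -> 0 < z -> 0 < c ->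
  n <= c * z ^+ m -> z^-1 <= c `^ m%:R^-1 * n `^ (- m%:R^-1).
Proof.
move=> m0 n0 z0 c0 h.
have mr : 0 < m%:R^-1 :> R by rewrite invr_gt0 ltr0n.
have h2 : n `^ m%:R^-1 <= c `^ m%:R^-1 * z.
  apply: (@le_trans _ _ ((c * z ^+ m) `^ m%:R^-1)).
    by apply: ge0_ler_powR; rewrite ?nnegrE ?(ltW mr) ?(ltW n0) // mulr_ge0 ?exprn_ge0 // ltW.
  rewrite powRM ?exprn_ge0 ?(ltW c0) ?(ltW z0) // -powR_mulrn ?(ltW z0) //.
  by rewrite -powRrM mulfV ?powRr1 ?(ltW z0) // pnatr_eq0 -lt0n.
have np : 0 < n `^ m%:R^-1 by exact: powR_gt0.
by rewrite powRN ler_pdivlMr // mulrC ler_pdivrMr.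
Qed.

Theorem theorem1p3 (R : realType) (k : nat) (hk : (0 < k)%N) :
  exists C : R, exists N : nat, forall n : nat, (N <= n)%N ->
    forall rho : R, 0 < rho < 1 -> rho * derive1 (Phi k) rho = n%:R ->
      let M := rho ^- n * Psi k rho / Num.sqrt (2 * pi * Phi2 k rho) in
      `| (pPk k n)%:R - M | <= C * M * (n%:R `^ (- (2 * k + 3)%:R^-1)).
Proof.
(* Here u^4 = w^e and v = w^H, so u^4 / v = w^(-(2k+2) e), exactly the (2k+3)-th root of
   P^(-(k+1)). *)
pose e := (4 * k + 12)%N; pose H := ((2 * k + 3) * e)%N.
have H0 : (0 < 2 * H)%N by rewrite /H /e; lia.
have kH : (k + 8 <= H)%N by rewrite /H /e; nia.
have [C0 C00 hC0] := prime_moments_le R.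
have [P1 hP1] := @minor_arc_sum R k H hk kH.
have [P2 hP2] := polylog_le (2 * H) 1.
pose N1 := (2 * H * k.+1)%N.
have [C1 C10 hC1] := @scaled_error_le R N1 k C0 C00.
pose c5 : R := C0 * 2 ^+ k * 2.
have c50 : 0 < c5 by rewrite !mulr_gt0 ?exprn_gt0.
pose P0 := maxn P1 (maxn P2 4).
(* If P < P0 then n <= C0 X (P + 1) <= C0 P0^(k+1), so the threshold on n makes P large enough for
   the asymptotic lemmas. *)
exists (C1 * c5 `^ (2 * k + 3)%:R^-1), (Num.truncn (C0 * P0%:R ^+ k.+1)).+1.
move=> n nN x x01 hn; cbv zeta; have /andP[x0 x1] := x01.
pose X := - (ln x)^-1.
have lnx : ln x < 0 by apply: ln_lt0.
have X0 : 0 < X by rewrite oppr_gt0 invr_lt0.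
have xE : x = expR (- X^-1) by rewrite /X invrN opprK invrK lnK.
have [P /andP[PX XP]] := exists_nat_root hk X0.
have mom N := hC0 k P N X hk X0 XP.
rewrite -xE in mom.
have cN := prime_mean_cvg hk x01; rewrite hn in cN.
have cV := prime_var_cvg hk x01.
have [Psi0 cZ] := Psi_cvg hk x01.
have nle : n%:R <= C0 * X * P.+1%:R.
  rewrite -(cvg_lim _ cN) //; apply: limr_le; first exact/cvgP/cN.
  by near=> N; have [] := mom N.
have PP0 : (P0 <= P)%N.
  rewrite leqNgt; apply/negP => PP.
  have h1 : n%:R <= C0 * P0%:R ^+ k.+1.
    apply: (le_trans nle); rewrite -mulrA ler_pM2l // exprSr; apply: ler_pM => //; last by rewrite ler_nat.
      exact: ltW.
    apply: (le_trans (ltW XP)); rewrite natrX; apply: lerXn2r; rewrite ?nnegrE //.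
    by rewrite ler_nat.
  have b0 : 0 <= C0 * P0%:R ^+ k.+1 by rewrite mulr_ge0 ?exprn_ge0 // ltW.
  by move: nN; rewrite ltnNge truncn_ge_nat // h1.
have PP1 : (P1 <= P)%N by apply: leq_trans PP0; rewrite leq_maxl.
have PP2 : (P2 <= P)%N by apply: leq_trans PP0; rewrite !leq_max leqnn orbT.
have P4 : (4 <= P)%N by apply: leq_trans PP0; rewrite !leq_max leqnn !orbT.
have Pr : 1 <= P%:R :> R by rewrite ler1n; apply: leq_trans P4.
have [w w1 wP] := exists_root Pr H0.
have w0 : 0 < w by apply: lt_le_trans w1.
pose v := w ^+ H; pose u := w ^+ (k + 3); pose D : R := P%:R ^+ k.
pose V := Phi2 k x; pose q := Num.sqrt (2 * pi * V); pose Y := X / D.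
have v1 : 1 <= v by exact: exprn_ege1.
have v2 : v ^+ 2 = P%:R by rewrite -wP /v -exprM mulnC.
have D1 : 1 <= D by exact: exprn_ege1.
have D0 : 0 < D by apply: lt_le_trans D1.
have YD : Y * D = X by rewrite divfK // gt_eqF.
have Y1 : 1 <= Y by rewrite ler_pdivlMr // mul1r /D -natrX.
have Y2 : Y <= 2 ^+ k.
  rewrite ler_pdivrMr // /D -exprMn; apply: (le_trans (ltW XP)).
  rewrite natrX; apply: lerXn2r; rewrite ?nnegrE ?mulr_ge0 //.
  by rewrite -natr1 mulr_natl mulr2n lerD2l.
have lw : (trunc_log 2 P).+1%:R <= w.
  rewrite -(ler_pXn2r H0) ?nnegrE ?(ltW w0) // wP -natrX ler_nat.
  by have := hP2 P PP2; rewrite mul1n.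
have VU : V <= C0 * X ^+ 2 * P.+1%:R.
  rewrite /V -(cvg_lim _ cV) //; apply: limr_le; first exact/cvgP/cV.
  by near=> N; have [] := mom N.
have VL0 : X ^+ 2 / 16 * (prime_count P)%:R <= V.
  rewrite /V -(cvg_lim _ cV) //; apply: limr_ge; first exact/cvgP/cV.
  by near=> N; rewrite [x in prime_var k x]xE; apply: prime_var_ge => //; near: N; exact: nbhs_infty_gt.
(* Chebyshev's bound loses one logarithm, replaced by w through [lw]. *)
have VL : X ^+ 2 * P%:R <= 64 * w * V.
  have hp : P%:R <= 4 * (w * (prime_count P)%:R).
    apply: (@le_trans _ _ (4 * ((trunc_log 2 P).+1%:R * (prime_count P)%:R))).
      rewrite -!natrM ler_nat; apply: (leq_trans (half_double_ge (ltnW (ltnW P4)))).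
      by rewrite leq_mul2l /=; apply: prime_count_ge; exact: trunc_log_ltn.
    by rewrite ler_pM2l // ler_wpM2r.
  apply: (@le_trans _ _ (X ^+ 2 * (4 * (w * (prime_count P)%:R)))).
    by rewrite ler_wpM2l ?sqr_ge0.
  have -> : X ^+ 2 * (4 * (w * (prime_count P)%:R)) = 64 * w * (X ^+ 2 / 16 * (prime_count P)%:R) by field.
  by rewrite ler_wpM2l // mulr_ge0 // ltW.
have V0 : 0 < V.
  have : 0 < 64 * w * V by apply: lt_le_trans VL; rewrite mulr_gt0 ?exprn_gt0 // (lt_le_trans _ Pr).
  by rewrite pmulr_rgt0 // mulr_gt0.
have pi0 := pi_gt0 R.
have pV0 : 0 < 2 * pi * V by rewrite mulr_gt0 // mulr_gt0.
have q0 : 0 < q by rewrite sqrtr_gt0.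
have q2 : q ^+ 2 = 2 * pi * V by rewrite sqr_sqrtr // ltW.
pose t0 := u / v / D.
have v0 : 0 < v by apply: lt_le_trans v1.
have u0 : 0 < u by rewrite exprn_gt0.
have ht0 : 0 <= t0 <= pi.
  apply/andP; split; first by rewrite !divr_ge0 // ltW.
  apply: (@le_trans _ _ 1); last by rewrite (le_trans _ (pi_ge2 R)) // ler1n.
  rewrite ler_pdivrMr // mul1r (le_trans _ D1) // ler_pdivrMr // mul1r.
  by rewrite ler_weXn2l // (leq_trans _ kH) // leq_add2l.
pose T := C0 * X ^+ 3 * P.+1%:R.
have h := @pPk_local_limit R k n P x V T t0 w (Psi k x)^-1 hk x01 V0 ht0 cN cV cZ.
have {h} := h (fun M => let: And3 _ _ h3 := mom M in h3).
move=> /(_ _ _) h.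
have hlim : `|(pPk k n)%:R * x ^+ n / Psi k x - q^-1| <=
    2 * T * t0 ^+ 4 + expR (- (w / 6)) + 2 * expR (- (V * t0 ^+ 2 / 4)) / q.
  apply: h => [p pp pP|t /andP[tt tpi]].
    by rewrite xE; have [] := geom_mean_ge_quarter X0 PX pp pP.
  exact: hP1.
have vD : v ^+ 2 * D <= w ^+ N1.
  by rewrite v2 /D /N1 exprM wP exprS.
have wu : w <= u by rewrite /u -[leLHS]expr1 ler_weXn2l // addn3.
have hs := hC1 w v u D Y V q w1 v1 wu D1 Y1 Y2 vD q0 q2.
rewrite YD v2 natr1 -/T -/t0 in hs.
have {hs} hs := hs VU VL.
pose z := w ^+ (2 * e * k.+1).
have z0 : 0 < z by rewrite exprn_gt0.
have uz : u ^+ 4 / v = z^-1.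
  have -> : v = u ^+ 4 * z.
    rewrite /v /u /z -exprM -exprD; congr (_ ^+ _); rewrite /H /e; ring.
  by rewrite invfM mulVKf // gt_eqF // exprn_gt0.
have n0 : 0 < n%:R :> R by rewrite ltr0n; apply: leq_trans nN.
have nz : n%:R <= c5 * z ^+ (2 * k + 3).
  have -> : z ^+ (2 * k + 3) = D * P%:R.
    rewrite /z -exprM (_ : (2 * e * k.+1 * (2 * k + 3))%N = (2 * H * k.+1)%N); last by rewrite /H; ring.
    by rewrite exprM wP exprSr.
  apply: (le_trans nle); rewrite -YD /c5.
  have -> : C0 * 2 ^+ k * 2 * (D * P%:R) = C0 * (2 ^+ k * D) * (2 * P%:R) by ring.
  apply: ler_pM => //.
  - by rewrite mulr_ge0 ?(ltW C00) // YD ltW.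
  - by rewrite ler_pM2l // ler_pM2r.
  - by rewrite -natr1 mulr_natl mulr2n lerD2l.
have zn : z^-1 <= c5 `^ (2 * k + 3)%:R^-1 * n%:R `^ (- (2 * k + 3)%:R^-1).
  by apply: inv_le_powR => //; rewrite addn3.
set M := x ^- n * Psi k x / _.
have M0 : 0 < M by rewrite divr_gt0 // mulr_gt0 // invr_gt0 exprn_gt0.
(* The prefactor equals M q, so the absolute error of the local limit becomes a relative one after
   multiplication by q, the form bounded by [scaled_error_le]. *)
have e1 : (pPk k n)%:R - M = (x ^- n * Psi k x) * ((pPk k n)%:R * x ^+ n / Psi k x - q^-1).
  rewrite /M -/V -/q; have xn : x ^+ n != 0 by rewrite gt_eqF // exprn_gt0.
  by field; rewrite xn !gt_eqF.
have xP0 : 0 < x ^- n * Psi k x by rewrite mulr_gt0 // invr_gt0 exprn_gt0.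
rewrite e1 normrM (gtr0_norm xP0).
apply: (le_trans (ler_wpM2l (ltW xP0) hlim)).
rewrite (_ : C1 * _ * M * _ = M * (C1 * (c5 `^ (2 * k + 3)%:R^-1 * n%:R `^ (- (2 * k + 3)%:R^-1)))); last by ring.
apply: (@le_trans _ _ (M * (C1 * z^-1))); last by rewrite ler_pM2l // ler_pM2l.
have xq : x ^- n * Psi k x = M * q by rewrite /M divfK // gt_eqF.
by rewrite xq -[leLHS]mulrA ler_pM2l // [leLHS]mulrC -uz.
Unshelve. all: by end_near.
Qed.
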